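(* Let $\Omega\subset\mathbb{R}^d$ be a bounded domain having a uniform exterior ball of some radius $r>0$. Let $g\in C^{1,1}(\bar\Omega)$ be $\lambda$-Lipschitz with $\lambda<1$, let $p\in[1,+\infty]$, and let $f\ge 0$ with $f\in L^p(\Omega)$. Let $T$ be a Borel selector of the map $x\mapsto\mathrm{argmin}\{|x-y|+g(y): y\in\partial\Omega\}$, and let $\sigma$ be the transport density between $f$ and $T_\#f$. Then $\sigma\in L^p(\Omega)$.
   Context: $\Omega$ has a uniform exterior ball of radius $r>0$ if for every $y\in\partial\Omega$ there is $x\in\mathbb{R}^d$ with $B(x,r)\cap\Omega=\emptyset$ and $|x-y|=r$. The function $f$ is identified with the measure $f\,dx$. A Borel selector of $x\mapsto \mathrm{argmin}\{|x-y|+g(y):y\in\partial\Omega\}$ is a Borel map $T:\bar\Omega\to\partial\Omega$ such that $T(x)$ belongs to this argmin for every $x\in\bar\Omega$; the argmin is a singleton for a.e. $x$. The transport density $\sigma$ between $f$ and $T_\#f$ is the positive measure on $\bar\Omega$ defined by $$\langle\sigma,\phi\rangle=\int_{\Omega}\int_0^1|x-T(x)|\,\phi\big((1-t)x+tT(x)\big)\,f(x)\,dt\,dx\qquad\text{for all }\phi\in C(\bar\Omega)$$ (the segments $[x,T(x)]$ lie in $\bar\Omega$). ''$\sigma\in L^p(\Omega)$'' means that $\sigma$ is absolutely continuous with respect to Lebesgue measure with density in $L^p(\Omega)$. *)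

(* Defs.v *)
From HB Require Import structures.
From mathcomp Require Import all_boot all_order all_algebra.
From mathcomp Require Import all_classical all_reals all_analysis.
From mathcomp Require Import measurable_realfun.

Set Implicit Arguments.
Unset Strict Implicit.
Unset Printing Implicit Defensive.
Import Order.TTheory GRing.Theory Num.Theory.
Import numFieldNormedType.Exports.

Local Open Scope classical_set_scope.
Local Open Scope ring_scope.

(* 'rV[R]_d carries its Borel sigma-algebra (generated by the open sets of the
   library topology, which is the Euclidean one). *)
HB.instance Definition _ (R : realType) (d : nat) :=
  @isMeasurable.Build (sigma_display (@open 'rV[R]_d)) 'rV[R]_d
    <<s @open 'rV[R]_d >> (@sigma_algebra0 _ setT _) (@sigma_algebraC _ _)
    (@sigma_algebra_bigcup _ setT _).

Section rV_borel.
Context {R : realType}.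

Lemma rV_open_measurable d (A : set 'rV[R]_d) : open A -> measurable A.
Proof. exact: sub_sigma_algebra. Qed.

Lemma rV_closed_measurable d (A : set 'rV[R]_d) : closed A -> measurable A.
Proof.
by move/closed_openC/rV_open_measurable/measurableC; rewrite setCK.
Qed.

Definition rV_ratr d (q : 'rV[rat]_d) : 'rV[R]_d := map_mx ratr q.

Lemma rV_bigcup_rat d (A : set 'rV[R]_d) : open A ->
  A = \bigcup_(p : 'rV[rat]_d * nat)
        [set x | ball (rV_ratr p.1) p.2.+1%:R^-1 `<=` A /\
                 ball (rV_ratr p.1) p.2.+1%:R^-1 x].
Proof.
move=> oA; apply/seteqP; split=> [x Ax|x [p _ [/[apply]//]]].
have /nbhs_ballP[e e0 eA] : nbhs x A by exact: open_nbhs_nbhs.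
pose k := Num.truncn (2 / e).
have k0 : 0 < k.+1%:R^-1 :> R by rewrite invr_gt0.
have ke : k.+1%:R^-1 < e / 2.
  rewrite -[e / 2]invrK ltf_pV2 ?posrE ?invr_gt0 ?divr_gt0// invf_div.
  exact: truncnS_gt.
have hq i : exists q : rat, ratr q \in `]x ord0 i, x ord0 i + k.+1%:R^-1[.
  by apply: rat_in_itvoo; rewrite ltrDl.
have kq : ball (rV_ratr (\row_i sval (cid (hq i))))
               k.+1%:R^-1 x.
  split=> // i j; rewrite (ord1 i) !mxE.
  case: (cid _) => q /=; rewrite in_itv/= => /andP[q1 q2].
  by rewrite /ball/= gtr0_norm ?subr_gt0// ltrBlDl.
exists (\row_i sval (cid (hq i)), k) => //; split=> //=.
move=> y qy; apply: eA.
rewrite (splitr e); apply: (@ball_triangle _ _ (rV_ratr (\row_i sval (cid (hq i))))).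
  by apply: ball_sym; apply: le_ball kq; exact: ltW.
by apply: le_ball qy; exact: ltW.
Qed.

Definition rV_cons d (z : measurableTypeR R * 'rV[R]_d) : 'rV[R]_d.+1 :=
  \row_i oapp (z.2 ord0) z.1 (unlift ord0 i).

Definition rV_uncons d (x : 'rV[R]_d.+1) : measurableTypeR R * 'rV[R]_d :=
  (x ord0 ord0, \row_i x ord0 (lift ord0 i)).

Lemma rV_consK d : cancel (@rV_cons d) (@rV_uncons d).
Proof.
case=> t y; rewrite /rV_cons /rV_uncons !mxE unlift_none/=; congr pair.
by apply/rowP => i; rewrite !mxE liftK.
Qed.

Lemma rV_cons_ball d (x : 'rV[R]_d.+1) (e : R) :
  @rV_cons d @^-1` ball x e =
  (ball (x ord0 ord0) e : set R) `*` ball (\row_i x ord0 (lift ord0 i)) e.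
Proof.
apply/seteqP; split=> -[t y]/=.
  move=> [e0 xe]; split.
    by have /= := xe ord0 ord0; rewrite !mxE unlift_none.
  split=> // i j; rewrite (ord1 i) mxE.
  by have /= := xe ord0 (lift ord0 j); rewrite !mxE liftK.
move=> -[/= xt [e0 xy]]; split=> // i j; rewrite (ord1 i) !mxE.
case: unliftP => [k ->|->]//=.
by have := xy ord0 k; rewrite !mxE.
Qed.

Lemma measurable_rV_cons d : measurable_fun setT (@rV_cons d).
Proof.
apply: (@measurability _ _ _ _ _ _ (@open 'rV[R]_d.+1)) => // _ [A oA <-].
rewrite setTI (rV_bigcup_rat oA) preimage_bigcup.
apply: countable_bigcupT_measurable; first exact: countableP.
move=> [q k]/=.
have [qA|qA] := pselect (ball (rV_ratr q) k.+1%:R^-1 `<=` A).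
  rewrite [X in measurable X](_ : _ =
    @rV_cons d @^-1` ball (rV_ratr q) k.+1%:R^-1); last first.
    by apply/seteqP; split=> [x []|x].
  rewrite rV_cons_ball; apply: measurableX.
    by apply: open_measurable; exact: ball_open.
  by apply: rV_open_measurable; apply: ball_open; rewrite invr_gt0.
rewrite [X in measurable X](_ : _ = set0)//.
by apply/seteqP; split=> [x []|x].
Qed.

Lemma rV_continuous_measurable d1 d2 (f : 'rV[R]_d1 -> 'rV[R]_d2) :
  continuous f -> measurable_fun setT f.
Proof.
move=> /continuousP cf.
apply: (@measurability _ _ _ _ _ _ (@open 'rV[R]_d2)) => // _ [A oA <-].
by rewrite setTI; apply: rV_open_measurable; exact: cf.
Qed.

Lemma measurable_rV_coord d (i : 'I_d) :
  measurable_fun setT (fun x : 'rV[R]_d => x ord0 i : measurableTypeR R).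
Proof.
apply: (measurability _ (RGenOpens.measurableE R)).
move=> _ [_ [a [b ->] <-]]; rewrite setTI; apply: rV_open_measurable.
have /continuousP := @coord_continuous R 1 d ord0 i.
by apply; exact: interval_open.
Qed.

Lemma measurable_rV_uncons d : measurable_fun setT (@rV_uncons d).
Proof.
apply: measurable_fun_pair; first exact: measurable_rV_coord.
apply: rV_continuous_measurable => x A /nbhs_ballP[e e0 eA].
apply/nbhs_ballP; exists e => // y [_ xy]; apply: eA; split=> // i j.
by rewrite !mxE; exact: xy.
Qed.

End rV_borel.

HB.instance Definition _ (R : realType) d :=
  isMeasurableFun.Build _ _ _ _ (@rV_cons R d) (@measurable_rV_cons R d).

Section lebesgue_succ.
Context {R : realType} (d : nat).
Variable mu : {sigma_finite_measure set 'rV[R]_d -> \bar R}.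
Local Open Scope ereal_scope.

Definition lebesgue_succ : set 'rV[R]_d.+1 -> \bar R :=
  pushforward (lebesgue_measure \x mu) (@rV_cons R d).

Let lebesgue_succ0 : lebesgue_succ set0 = 0.
Proof. exact: measure0. Qed.

Let lebesgue_succ_ge0 A : 0 <= lebesgue_succ A.
Proof. exact: measure_ge0. Qed.

Let lebesgue_succ_sigma_additive : semi_sigma_additive lebesgue_succ.
Proof.
exact: (@measure_semi_sigma_additive _ _ _
  (pushforward (lebesgue_measure \x mu) (@rV_cons R d))).
Qed.

HB.instance Definition _ := isMeasure.Build _ _ _ lebesgue_succ
  lebesgue_succ0 lebesgue_succ_ge0 lebesgue_succ_sigma_additive.

Let lebesgue_succ_sigma_finite : sigma_finite setT lebesgue_succ.
Proof.
have /sigma_finiteP[F [TF ndF Foo]] := sigma_finiteT (@lebesgue_measure R).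
have /sigma_finiteP[G [TG ndG Goo]] := sigma_finiteT mu.
exists (fun k => @rV_uncons R d @^-1` (F k `*` G k)).
  rewrite -preimage_bigcup (_ : \bigcup_i _ = setT) ?preimage_setT//.
  rewrite -subTset => -[x y] _.
  have [n _ Fnx] : (\bigcup_k F k) x by rewrite -TF.
  have [k _ Gky] : (\bigcup_k G k) y by rewrite -TG.
  exists (maxn n k) => //; split => /=.
  - by move: x Fnx; exact/subsetPset/ndF/leq_maxl.
  - by move: y Gky; exact/subsetPset/ndG/leq_maxr.
move=> k; have [mF Fk] := Foo k; have [mG Gk] := Goo k; split.
  rewrite -[X in measurable X]setTI; apply: measurable_rV_uncons => //.
  exact: measurableX.
rewrite /lebesgue_succ /pushforward -comp_preimage.
rewrite (_ : _ \o _ = id) ?preimage_id; last first.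
  by apply/funext => z /=; rewrite rV_consK.
by rewrite product_measure1E// lte_mul_pinfty// ge0_fin_numE.
Qed.

HB.instance Definition _ := Measure_isSigmaFinite.Build _ _ _ lebesgue_succ
  lebesgue_succ_sigma_finite.

End lebesgue_succ.

(* d-dimensional Lebesgue measure, as the iterated product of one-dimensional
   Lebesgue measures; rV_lebesgue_box below computes it on boxes. *)
Fixpoint rV_lebesgue (R : realType) (d : nat) :
    {sigma_finite_measure set 'rV[R]_d -> \bar R} :=
  if d is d'.+1 then lebesgue_succ (rV_lebesgue R d') else \d_(0 : 'rV[R]_0).

Lemma rV_box_measurable (R : realType) d (a b : 'rV[R]_d) :
  measurable [set x : 'rV[R]_d | forall i, a ord0 i <= x ord0 i <= b ord0 i].
Proof.
rewrite (_ : mkset _ = \bigcap_(i in [set: 'I_d])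
    ((fun x : 'rV[R]_d => x ord0 i) @^-1` `[a ord0 i, b ord0 i])); last first.
  by apply/seteqP; split=> x /= xab i => [_|]; have /= := xab i;
    rewrite in_itv/=; last exact.
apply: fin_bigcap_measurable => // i _.
by rewrite -[X in measurable X]setTI; exact: measurable_rV_coord.
Qed.

Lemma rV_lebesgue_box (R : realType) d (a b : 'rV[R]_d) :
  (forall i, a ord0 i <= b ord0 i) ->
  rV_lebesgue R d [set x | forall i, a ord0 i <= x ord0 i <= b ord0 i] =
  (\prod_(i < d) (b ord0 i - a ord0 i))%:E.
Proof.
elim: d a b => [|d IH] a b ab.
  by rewrite big_ord0 /= diracE mem_set//= => -[].
rewrite big_ord_recl /= /lebesgue_succ /pushforward.
pose a' : 'rV[R]_d := \row_i a ord0 (lift ord0 i).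
pose b' : 'rV[R]_d := \row_i b ord0 (lift ord0 i).
rewrite (_ : _ @^-1` _ = `[a ord0 ord0, b ord0 ord0]%classic `*`
    [set y : 'rV[R]_d | forall i, a' ord0 i <= y ord0 i <= b' ord0 i]).
  rewrite product_measure1E//; last exact: rV_box_measurable.
  rewrite IH; last by move=> i; rewrite !mxE.
  rewrite EFinM; congr (_ * _)%E.
    apply: (eq_trans (lebesgue_measure_itv `[a ord0 ord0, b ord0 ord0])).
    rewrite /= lte_fin; case: ltP => [//|ba]; rewrite (_ : b ord0 ord0 = a ord0 ord0) ?subrr//.
    by apply/eqP; rewrite eq_le ba ab.
  by congr EFin; apply: eq_bigr => i _; rewrite !mxE.
apply/seteqP; split=> -[t y] /= tyab.
  split.
    by have := tyab ord0; rewrite in_itv !mxE unlift_none.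
  by move=> i; have := tyab (lift ord0 i); rewrite !mxE liftK.
case: tyab => tab yab i; rewrite mxE; case: unliftP => [j ->|->] /=.
  by have := yab j; rewrite !mxE.
by move: tab; rewrite in_itv.
Qed.

Section transport.
Context {R : realType} {d : nat}.
Implicit Types (Omega : set 'rV[R]_d) (x y : 'rV[R]_d) (g f : 'rV[R]_d -> R).

(* The library norm `|x| on 'rV[R]_d is the sup norm. *)
Definition enorm x : R := Num.sqrt (\sum_i x ord0 i ^+ 2).

Definition eball x (r : R) : set 'rV[R]_d := [set y | enorm (y - x) < r].

Definition boundary Omega := closure Omega `\` Omega°.

Definition bounded_domain Omega :=
  [/\ Omega !=set0, open Omega, connected Omega & bounded_set Omega].

Definition uniform_exterior_ball Omega (r : R) :=
  forall y, boundary Omega y ->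
    exists x, eball x r `&` Omega = set0 /\ enorm (x - y) = r.

Definition elipschitz_on (A : set 'rV[R]_d) (k : R) g :=
  forall x y, A x -> A y -> `|g x - g y| <= k * enorm (x - y).

Definition gradient g x : 'rV[R]_d := \row_i 'D_(delta_mx ord0 i) g x.

(* C^{1,1} up to the boundary: the derivatives up to order one extend
   continuously to the closure and the gradient is Lipschitz.  The extension of
   the gradient is not required separately, since a function that is Lipschitz on
   Omega extends continuously to the closure.  Only the values of g on the closure
   of Omega matter. *)
Definition C11_closure Omega g :=
  [/\ {within closure Omega, continuous g},
      forall x, Omega x -> differentiable g x
    & exists k : R, forall x y, Omega x -> Omega y ->
        enorm (gradient g x - gradient g y) <= k * enorm (x - y)].

Definition boundary_argmin Omega g x : set 'rV[R]_d :=
  [set y | boundary Omega y /\ forall z, boundary Omega z ->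
    enorm (x - y) + g y <= enorm (x - z) + g z].

Definition borel_selector Omega g (T : 'rV[R]_d -> 'rV[R]_d) :=
  measurable_fun (closure Omega) T /\
  forall x, closure Omega x -> boundary_argmin Omega g x (T x).

(* Classes in L^p(Omega) are given by Borel representatives on Omega. *)
Definition memLp Omega (p : \bar R) f :=
  measurable_fun Omega f /\
  (Lnorm (rV_lebesgue R d) p (fun x => (f x * \1_Omega x)%:E) < +oo)%E.

(* sigma is only required to be a Borel measure carried by the closure of Omega:
   phi = 1 forces it to be finite, so it is determined by these identities. *)
Definition is_transport_density Omega f (T : 'rV[R]_d -> 'rV[R]_d)
    (sigma : {measure set 'rV[R]_d -> \bar R}) :=
  sigma (~` closure Omega) = 0%E /\
  forall phi : 'rV[R]_d -> R, {within closure Omega, continuous phi} ->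
    (\int[sigma]_(x in closure Omega) (phi x)%:E =
     \int[rV_lebesgue R d]_(x in Omega) \int[lebesgue_measure]_(t in `[0%R, 1%R])
       (enorm (x - T x) * phi ((1 - t) *: x + t *: T x) * f x)%:E)%E.

Definition measure_in_Lp Omega (p : \bar R)
    (sigma : {measure set 'rV[R]_d -> \bar R}) :=
  sigma `<< rV_lebesgue R d /\
  exists h : 'rV[R]_d -> R, memLp Omega p h /\
    forall A, measurable A ->
      sigma A = (\int[rV_lebesgue R d]_(x in A `&` Omega) (h x)%:E)%E.

End transport.

(* Main.v *)
From HB Require Import structures.
From mathcomp Require Import all_boot all_order all_algebra.
From mathcomp Require Import all_classical all_reals all_analysis.
From mathcomp Require Import measurable_realfun ess_sup_inf ring lra.
Require Import Defs.

Set Implicit Arguments.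
Unset Strict Implicit.
Unset Printing Implicit Defensive.
Import Order.TTheory GRing.Theory Num.Theory.
Import numFieldNormedType.Exports.

Local Open Scope classical_set_scope.
Local Open Scope ring_scope.

(* Write e(x) for the unit vector from x towards T(x). The distance-type function
   u(x) = |x - T(x)| + g(T(x)) decreases with slope one along the segments [x, T(x)]. The exterior
   ball, the transversality of the segments to the boundary (from lambda < 1) and the Lipschitz
   gradient of g give a quadratic upper bound for u at every point of a segment, uniformly up to
   the boundary but only on small enough balls; the point lying at distance s behind on the
   segment gives a quadratic lower bound with constant 1/(2s). Together they show that
   x |-> x + s e(x) has locally a Lipschitz inverse with a constant uniform in s, so the
   pull-back of Lebesgue measure under it is at most C times Lebesgue measure. Integrating
   over s, the segments through a set A, weighted by their length in A, have total mass at most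
   C |A|. This gives the case p = +oo; splitting f at a multiple of the level of the density
   gives the other p. *)

(** Since [T] is only Borel, there is no Jacobian to estimate. The change of variables is replaced
    by a count of grid cells of side comparable to [h]: it suffices that points with images within
    [h / 2] of each other are within [L * h], where [L] depends neither on [h] nor on [s]. This is
    why semiconcavity is stated at a scale, with error [K * h ^+ 2] on the whole ball of radius [h].
    The obstacle is uniformity near the boundary. Keeping the endpoint [y] as competitor for a
    displaced point costs [1 / (2 * rho)], which blows up as the distance [rho] to [y] tends to 0.
    The competitor is therefore moved with the point: the direction of travel stays fixed, so that
    the length is affine, and the only quadratic errors come from the curvature of the exterior ball
    and the oscillation of the gradient of [g]. The admissible scale still depends on the remaining
    length of the segment, but this dependence disappears in an exhaustion as [h] tends to 0. For
    finite [p], the splitting is a real interpolation between the bounds for [p = 1] and [p = +oo],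
    done on dyadic levels of the density. *)

(** * Euclidean inner product and norm, and comparison with the sup norm *)

Section euclidean.
Context {R : realType} {d : nat}.
Implicit Types x y z e v : 'rV[R]_d.

Definition dotp x y : R := \sum_i x ord0 i * y ord0 i.

Lemma dotpC x y : dotp x y = dotp y x.
Proof. by apply: eq_bigr => i _; rewrite mulrC. Qed.

Lemma dotpDl x y z : dotp (x + y) z = dotp x z + dotp y z.
Proof. by rewrite -big_split; apply: eq_bigr => i _; rewrite mxE mulrDl. Qed.

Lemma dotpDr x y z : dotp z (x + y) = dotp z x + dotp z y.
Proof. by rewrite dotpC dotpDl !(dotpC z). Qed.

Lemma dotpZl a x y : dotp (a *: x) y = a * dotp x y.
Proof. by rewrite /dotp mulr_sumr; apply: eq_bigr => i _; rewrite mxE mulrA. Qed.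

Lemma dotpZr a x y : dotp x (a *: y) = a * dotp x y.
Proof. by rewrite dotpC dotpZl dotpC. Qed.

Lemma dotpNl x y : dotp (- x) y = - dotp x y.
Proof. by rewrite -scaleN1r dotpZl mulN1r. Qed.

Lemma dotpNr x y : dotp x (- y) = - dotp x y.
Proof. by rewrite dotpC dotpNl dotpC. Qed.

Definition dotpE := (dotpDl, dotpDr, dotpZl, dotpZr, dotpNl, dotpNr).

Lemma dotp0l x : dotp 0 x = 0.
Proof. by rewrite -(scale0r x) dotpZl mul0r. Qed.

Lemma dotp_ge0 x : 0 <= dotp x x.
Proof. by apply: sumr_ge0 => i _; rewrite -expr2 sqr_ge0. Qed.

Lemma enormE x : enorm x = Num.sqrt (dotp x x).
Proof. by congr Num.sqrt; apply: eq_bigr => i _; rewrite expr2. Qed.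

Lemma enorm_ge0 x : 0 <= enorm x.
Proof. exact: sqrtr_ge0. Qed.

Lemma enorm_sqr x : enorm x ^+ 2 = dotp x x.
Proof. by rewrite enormE sqr_sqrtr ?dotp_ge0. Qed.

Lemma enorm_le x (a : R) : 0 <= a -> (enorm x <= a) = (dotp x x <= a ^+ 2).
Proof. by move=> a0; rewrite -enorm_sqr ler_sqr ?nnegrE ?enorm_ge0. Qed.

Lemma enorm_lt x (a : R) : 0 <= a -> (enorm x < a) = (dotp x x < a ^+ 2).
Proof. by move=> a0; rewrite -enorm_sqr ltr_sqr ?nnegrE ?enorm_ge0. Qed.

Lemma enorm0 : enorm (0 : 'rV[R]_d) = 0.
Proof. by rewrite enormE dotp0l sqrtr0. Qed.

Lemma enorm_eq0 x : (enorm x == 0) = (x == 0).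
Proof.
apply/eqP/eqP => [x0|->]; last exact: enorm0.
apply/rowP => i; rewrite mxE.
have : dotp x x = 0 by rewrite -enorm_sqr x0 expr0n.
move/eqP; rewrite psumr_eq0 => [/allP/(_ i)|j _]; last by rewrite -expr2 sqr_ge0.
by rewrite mem_index_enum => /(_ isT); rewrite /= -expr2 sqrf_eq0 => /eqP.
Qed.

Lemma enorm_gt0 x : (0 < enorm x) = (x != 0).
Proof. by rewrite lt_def enorm_ge0 andbT enorm_eq0. Qed.

Lemma enormZ a x : enorm (a *: x) = `|a| * enorm x.
Proof.
by rewrite !enormE !dotpE mulrA -expr2 sqrtrM ?sqr_ge0// sqrtr_sqr.
Qed.

Lemma enormN x : enorm (- x) = enorm x.
Proof. by rewrite -scaleN1r enormZ normrN1 mul1r. Qed.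

Lemma enorm_distC x y : enorm (x - y) = enorm (y - x).
Proof. by rewrite -enormN opprB. Qed.

Lemma dotp_le_enorm x y : dotp x y <= enorm x * enorm y.
Proof.
have [->|x0] := eqVneq x 0; first by rewrite dotp0l enorm0 mul0r.
have [->|y0] := eqVneq y 0; first by rewrite dotpC dotp0l enorm0 mulr0.
have a0 : 0 < enorm x by rewrite enorm_gt0.
have b0 : 0 < enorm y by rewrite enorm_gt0.
have := dotp_ge0 (enorm y *: x - enorm x *: y).
rewrite !dotpE (dotpC y x) -!enorm_sqr.
move: (enorm x) (enorm y) (dotp x y) a0 b0 => a b c a0 b0 H.
have {H}: 0 <= (a * b) * (a * b - c) by lra.
by rewrite pmulr_rge0 ?mulr_gt0// subr_ge0.
Qed.

Lemma normr_dotp_le x y : `|dotp x y| <= enorm x * enorm y.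
Proof.
rewrite ler_norml dotp_le_enorm andbT lerNl -dotpNl -(enormN x).
exact: dotp_le_enorm.
Qed.

Lemma ler_enormD x y : enorm (x + y) <= enorm x + enorm y.
Proof.
rewrite enorm_le ?addr_ge0 ?enorm_ge0// !dotpE (dotpC y x) -!enorm_sqr.
have := dotp_le_enorm x y; lra.
Qed.

Lemma ler_enorm_dist y x z : enorm (x - z) <= enorm (x - y) + enorm (y - z).
Proof. by rewrite (_ : x - z = x - y + (y - z)) ?ler_enormD// addrA subrK. Qed.

Lemma normr_coord_le x i : `|x ord0 i| <= enorm x.
Proof.
rewrite -sqrtr_sqr enormE ler_wsqrtr// /dotp (bigD1 i)//= -expr2 lerDl.
by apply: sumr_ge0 => j _; rewrite -expr2 sqr_ge0.
Qed.

Lemma normr_le_enorm x : `|x| <= enorm x.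
Proof.
rewrite [X in X <= _]mx_normrE; apply: bigmax_le; first exact: enorm_ge0.
by move=> -[i j] _ /=; rewrite (ord1 i) normr_coord_le.
Qed.

Lemma enorm_le_normr x : enorm x <= d%:R * `|x|.
Proof.
rewrite enorm_le ?mulr_ge0//.
apply: (@le_trans _ _ (\sum_(i < d) `|x| ^+ 2)).
  apply: ler_sum => i _; rewrite -expr2 -real_normK ?num_real// ler_sqr ?nnegrE//.
  rewrite [X in _ <= X]mx_normrE.
  exact: (@le_bigmax _ _ _ 0 (fun i : 'I_1 * 'I_d => `|x i.1 i.2|) (ord0, i)).
rewrite sumr_const card_ord exprMn -[leLHS]mulr_natl ler_wpM2r ?sqr_ge0//.
by rewrite -natrX ler_nat; case: d => // n; rewrite leq_pmulr.
Qed.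

(** The squares of the two sides differ by the square of [dotp e v + enorm v ^+ 2 / (2 * s)]. This
    is the source of the constant [1 / (2 * s)] in the lower bounds. *)
Lemma enormDZ_le (s : R) e v : 0 < s -> enorm e = 1 ->
  enorm (s *: e + v) <= s + dotp e v + enorm v ^+ 2 / (2 * s).
Proof.
move=> s0 e1; have := dotp_le_enorm (- e) v.
rewrite dotpNl enormN e1 mul1r => ev.
have h0 : 0 <= s + dotp e v + enorm v ^+ 2 / (2 * s).
  rewrite (_ : _ + _ = (s + dotp e v + enorm v) +
      ((enorm v - s) ^+ 2 - s ^+ 2) / (2 * s)); last by field; lra.
  rewrite (_ : _ + _ = (dotp e v + enorm v) + s/2 +
      ((enorm v - s) ^+ 2) / (2 * s)); last by field; lra.
  have : 0 <= ((enorm v - s) ^+ 2) / (2 * s).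
    by rewrite divr_ge0 ?sqr_ge0// mulr_ge0// ltW.
  by move: (_ / (2*s)) => q; lra.
rewrite enorm_le// !dotpE (dotpC v e) -!enorm_sqr e1.
move: (dotp e v) (enorm v) ev => a b ev {h0}.
rewrite -subr_ge0 (_ : _ - _ = (a + b ^+2 / (2 * s)) ^+ 2); last by field; lra.
by rewrite sqr_ge0.
Qed.

End euclidean.

(** * Topology in terms of the Euclidean norm, and exit points of segments *)

Section exit.
Context {R : realType} {d : nat}.
Implicit Types (A : set 'rV[R]_d) (x y : 'rV[R]_d).

Lemma open_enormP A :
  open A <-> forall x, A x -> exists2 e : R, 0 < e & forall y, enorm (y - x) < e -> A y.
Proof.
split=> [oA x Ax|h].
  have /nbhs_ballP[e e0 eA] : nbhs x A by exact: open_nbhs_nbhs.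
  exists e => // y yx; apply: eA; apply: ball_sym.
  rewrite -ball_normE /ball_ /=.
  by apply: le_lt_trans yx; rewrite normr_le_enorm.
rewrite openE => x Ax; rewrite /interior; have [e e0 eA] := h x Ax.
(* The sup norm controls [enorm] up to the factor [d]; [d.+1] avoids a division by zero when
   [d = 0]. *)
apply/nbhs_ballP; exists (e / d.+1%:R); first by rewrite /= divr_gt0.
move=> y; rewrite -ball_normE /ball_ /= => xy; apply: eA.
apply: le_lt_trans (enorm_le_normr _) _.
rewrite ltr_pdivlMr// mulrC distrC in xy; apply: le_lt_trans xy.
by rewrite ler_wpM2r// ler_nat.
Qed.

Lemma closure_enormP A x :
  closure A x <-> forall e : R, 0 < e -> exists2 y, A y & enorm (y - x) < e.
Proof.
split=> [cA e e0|h B /nbhs_ballP[e e0 eB]].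
  have [|y [Ay]] := cA (ball x (e / d.+1%:R)).
    by apply: nbhsx_ballx; rewrite divr_gt0.
  rewrite -ball_normE /ball_ /= => xy; exists y => //.
  apply: le_lt_trans (enorm_le_normr _) _.
  rewrite ltr_pdivlMr// mulrC distrC in xy; apply: le_lt_trans xy.
  by rewrite ler_wpM2r// ler_nat.
have [y Ay yx] := h e e0; exists y; split=> //; apply: eB; apply: ball_sym.
by rewrite -ball_normE /ball_ /=; apply: le_lt_trans yx; rewrite normr_le_enorm.
Qed.

Lemma boundary_open A x : open A -> boundary A x <-> closure A x /\ ~ A x.
Proof. by move=> oA; rewrite /boundary (interior_id A).1. Qed.

Lemma segment_exit A a b : open A -> A a -> ~ A b ->
  exists2 t : R, 0 < t <= 1 & boundary A (a + t *: (b - a)) /\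
    forall s, 0 <= s < t -> A (a + s *: (b - a)).
Proof.
move=> oA Aa Ab; pose l (t : R) := a + t *: (b - a).
have lB s t : enorm (l s - l t) = `|s - t| * enorm (b - a).
  by rewrite -enormZ; congr enorm; rewrite /l opprD addrACA subrr add0r scalerBl.
have near_l t : A (l t) -> exists2 e, 0 < e & forall s, `|s - t| < e -> A (l s).
  move/open_enormP : oA => /[apply] -[e e0 eA].
  exists (e / (enorm (b - a) + 1)); first by rewrite divr_gt0// ltr_wpDl// enorm_ge0.
  move=> s; rewrite ltr_pdivlMr ?ltr_wpDl// ?enorm_ge0// => st; apply: eA.
  by rewrite lB; apply: le_lt_trans st; rewrite ler_wpM2l// lerDl.
(* The exit time is [inf E]. Openness of [A] makes it positive and puts the exit point outside [A],
   while all earlier points lie in [A]. *)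
pose E := [set t | 0 <= t <= 1 /\ ~ A (l t)].
have E1 : E 1 by split; [rewrite ler01 lexx|rewrite /l scale1r addrC subrK].
have lbE : has_lbound E by exists 0 => t -[/andP[]].
have t0 : 0 <= inf E by apply: lb_le_inf; [exists 1|move=> t -[/andP[]]].
have t1 : inf E <= 1 by exact: ge_inf.
have lA s : 0 <= s < inf E -> A (l s).
  move=> /andP[s0 sE]; apply: contrapT => nA.
  have /(ge_inf lbE) : E s by split=> //; rewrite s0 (le_trans (ltW sE)).
  by rewrite leNgt sE.
have nA : ~ A (l (inf E)).
  move=> /near_l[e e0 eA].
  have [x [x01 nAx] xE] := inf_adherent e0 (conj (ex_intro _ 1 E1) lbE).
  have Ex : inf E <= x by apply: ge_inf.
  by apply: nAx; apply: eA; rewrite ger0_norm ?subr_ge0// ltrBlDl.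
have {}t0 : 0 < inf E.
  rewrite lt_neqAle t0 andbT; apply/eqP => t0'; apply: nA.
  by rewrite -t0' /l scale0r addr0.
exists (inf E); first by rewrite t0.
split=> //; apply/boundary_open => //; split=> //.
apply/closure_enormP => e e0.
pose k := enorm (b - a) + 1; have k0 : 0 < k by rewrite ltr_wpDl// enorm_ge0.
exists (l (Num.max 0 (inf E - e / k))).
  by apply: lA; rewrite le_max lexx/= gt_max t0 gtrBl divr_gt0.
rewrite -/(l (inf E)) lB ler0_norm; last by rewrite subr_le0 ge_max (ltW t0) gerBl divr_ge0// ltW.
have m : - (Num.max 0 (inf E - e / k) - inf E) <= e / k.
  by rewrite opprB lerBlDr -lerBlDl le_max lexx orbT.
apply: le_lt_trans (ler_wpM2r (enorm_ge0 _) m) _.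
by rewrite -mulrA -[ltRHS]mulr1 ltr_pM2l// ltr_pdivrMl// mulr1 /k ltrDl.
Qed.

End exit.

(** * Mean value theorem on segments whose ends may lie on the boundary *)

Section mean_value.
Context {R : realType} {d : nat}.
Implicit Types (x y v : 'rV[R]_d) (g : 'rV[R]_d -> R).

Lemma derive_gradient g x v : differentiable g x -> 'D_v g x = dotp (gradient g x) v.
Proof.
move=> gx; rewrite deriveE// [X in _ X = _](row_sum_delta v) linear_sum /dotp.
by apply: eq_bigr => i _; rewrite linearZ !mxE -deriveE// mulrC.
Qed.

(** At the ends nothing is known about derivatives; continuity of [g] along the closed segment comes
    from its Lipschitz bound. *)
Lemma gradient_MVT Omega g (la : R) x y :
  (forall x, Omega x -> differentiable g x) -> elipschitz_on (closure Omega) la g ->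
  closure Omega x -> closure Omega y ->
  (forall t : R, 0 < t < 1 -> Omega (x + t *: (y - x))) ->
  exists2 t : R, 0 < t < 1 &
    g y - g x = dotp (gradient g (x + t *: (y - x))) (y - x).
Proof.
move=> dg lg cx cy xyO; pose l (t : R^o) : 'rV[R]_d := x + t *: (y - x).
have cl t : 0 <= t <= 1 -> closure Omega (l t).
  move=> /andP[]; rewrite le_eqVlt => /predU1P[<- _|t0].
    by rewrite /l scale0r addr0.
  rewrite le_eqVlt => /predU1P[->|t1]; first by rewrite /l scale1r addrC subrK.
  by apply: subset_closure; apply: xyO; rewrite t0 t1.
have lB s t : enorm (l s - l t) = `|s - t| * enorm (y - x).
  by rewrite -enormZ; congr enorm; rewrite /l opprD addrACA subrr add0r scalerBl.
have dl (t : R^o) : is_diff t l ( *:%R^~ (y - x)).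
  have : is_diff t (cst x + *:%R^~ (y - x)) (0 + *:%R^~ (y - x)) by exact: is_diffD.
  by rewrite add0r.
have [| |t] := @MVT R (g \o l) (fun t => dotp (gradient g (l t)) (y - x)) 0 1 ltr01.
- move=> t; rewrite in_itv/= => t01.
  have dgt : differentiable g (l t) by apply: dg; exact: xyO.
  have [dlt dlE] := dl t.
  apply: DeriveDef; first by apply/derivable1_diffP; exact: differentiable_comp.
  rewrite deriveE; last exact: differentiable_comp.
  by rewrite diff_comp//= dlE scale1r -deriveE// derive_gradient.
- apply/subspace_continuousP => t /=; rewrite in_itv/= => t01.
  apply/cvgrPdist_lt => e e0; rewrite near_withinE.
  pose k := `|la| * enorm (y - x) + 1.
  have k0 : 0 < k by rewrite ltr_wpDl// mulr_ge0// enorm_ge0.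
  near=> s; rewrite /= in_itv/= => s01.
  apply: le_lt_trans (lg _ _ (cl _ t01) (cl _ s01)) _.
  have ts : `|t - s| < e / k.
    by near: s; apply: (@cvgr_dist_lt _ _ _ (nbhs t) _ id t) => //; exact: divr_gt0.
  rewrite lB; move: ts; rewrite ltr_pdivlMr//; apply: le_lt_trans.
  rewrite mulrCA ler_wpM2l// /k; apply: (@le_trans _ _ (`|la| * enorm (y - x))).
    by rewrite ler_wpM2r ?enorm_ge0// ler_norm.
  by rewrite lerDl.
have l1 : g (l 1) = g y by rewrite /l scale1r addrC subrK.
have l0 : g (l 0) = g x by rewrite /l scale0r addr0.
rewrite in_itv/= => t01 E; exists t => //.
by move: E; rewrite /= l1 l0 subr0 mulr1.
Unshelve. all: by end_near. Qed.

End mean_value.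

(** * Geometry of minimizing segments: cones inside the domain, transversality at the boundary *)

Section rays.
Context {R : realType} {d : nat}.
Context (Omega : set 'rV[R]_d) (g : 'rV[R]_d -> R) (la : R).
Context (oO : open Omega) (la0 : 0 <= la) (la1 : la < 1).
Context (lg : elipschitz_on (closure Omega) la g).
Implicit Types x y z e v w : 'rV[R]_d.

(* If [y] is a minimizer for [z], then [Omega] contains the open cone with apex [y], axis [z - y]
   and this slope. *)
Definition cone_slope : R := (1 - la) / (1 + la).
Local Notation c := cone_slope.

Lemma cone_slope_gt0 : 0 < c.
Proof. by have := la0; have := la1 => h1 h0; apply: divr_gt0; lra. Qed.

Lemma argmin_gap z y y' : boundary_argmin Omega g z y -> boundary Omega y' ->
  enorm (z - y) <= enorm (z - y') + la * enorm (y - y').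
Proof.
move=> [[cy _] h] by'; have {}h := h _ by'; case: by' => cy' _.
have := lg cy' cy; rewrite (enorm_distC y').
by have := ler_norm (g y' - g y); lra.
Qed.

Lemma argmin_enorm_gt0 z y : Omega z -> boundary_argmin Omega g z y -> 0 < enorm (z - y).
Proof.
move=> Oz [/(boundary_open _ oO)[_ nOy] _].
by rewrite enorm_gt0 subr_eq0; apply: contra_not_neq nOy => <-.
Qed.

(** If the segment from [z] to [w] left [Omega] at [y'], then [argmin_gap] and the triangle
    inequality would give [(1 - la) * enorm (z - y) <= (1 + la) * enorm (z - y')]. This is the
    origin of the slope. *)
Lemma argmin_ball_in z y w : Omega z -> boundary_argmin Omega g z y ->
  enorm (w - z) < c * enorm (z - y) -> Omega w.
Proof.
have l0 := la0; have l1 := la1.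
move=> Oz zy wz; apply: contrapT => nOw.
have [t /andP[t0 t1] [by' _]] := segment_exit oO Oz nOw.
have := argmin_gap zy by'; have := ler_enorm_dist z y (z + t *: (w - z)).
set y' := z + t *: (w - z).
have -> : enorm (z - y') = t * enorm (w - z).
  by rewrite /y' opprD addrA subrr add0r enormN enormZ gtr0_norm.
move=> h1 h2; rewrite (enorm_distC y z) in h1.
have h3 : t * enorm (w - z) <= enorm (w - z) by rewrite ler_piMl ?enorm_ge0.
have h4 : la * enorm (y - y') <= la * (enorm (z - y) + t * enorm (w - z)) by rewrite ler_wpM2l.
have h5 : (1 + la) * (t * enorm (w - z)) <= (1 + la) * enorm (w - z) by rewrite ler_wpM2l//; lra.
move: wz; rewrite /c mulrAC ltr_pdivlMr; lra.
Qed.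

Lemma ray_dist z e (s t : R) : enorm e = 1 -> enorm (z + s *: e - (z + t *: e)) = `|s - t|.
Proof. by move=> e1; rewrite opprD addrACA subrr add0r -scalerBl enormZ e1 mulr1. Qed.

Lemma ray_dist0 z e (t : R) : enorm e = 1 -> enorm (z - (z + t *: e)) = `|t|.
Proof. by move=> e1; rewrite opprD addrA subrr add0r enormN enormZ e1 mulr1. Qed.

Lemma argmin_along_ray z e (rho s : R) : enorm e = 1 -> 0 <= s <= rho ->
  boundary_argmin Omega g z (z + rho *: e) ->
  boundary_argmin Omega g (z + s *: e) (z + rho *: e).
Proof.
move=> e1 /andP[s0 srho] [by_ hy]; split=> // y' /hy.
rewrite ray_dist// ray_dist0// distrC !ger0_norm//; [|lra..].
have := ler_enorm_dist (z + s *: e) z y'.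
by rewrite ray_dist0// (ger0_norm s0); lra.
Qed.

(** A boundary point [y'] strictly between [z] and the endpoint would be a cheaper target: stopping
    there saves the remaining length and raises [g] by at most [la] times that length. *)
Lemma ray_in z e (rho s : R) : enorm e = 1 -> 0 <= s < rho -> Omega z ->
  boundary_argmin Omega g z (z + rho *: e) -> Omega (z + s *: e).
Proof.
have l0 := la0; have l1 := la1.
move=> e1 /andP[s0 srho] Oz zy; apply: contrapT => nO.
have [t /andP[t0 t1] [by' _]] := segment_exit oO Oz nO.
have := argmin_gap zy by'.
rewrite (addrC z (s *: e)) addrK scalerA ray_dist// !ray_dist0//.
have ts : t * s <= s by rewrite ler_piMl.
have ts0 : 0 <= t * s by rewrite mulr_ge0// ltW.
rewrite !ger0_norm; [|lra..] => h.
have : la * (rho - t * s) < rho - t * s by rewrite gtr_pMl//; lra.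
lra.
Qed.

Lemma ray_ball_in z e (rho s : R) w : enorm e = 1 -> 0 <= s < rho -> Omega z ->
  boundary_argmin Omega g z (z + rho *: e) ->
  enorm (w - (z + s *: e)) < c * (rho - s) -> Omega w.
Proof.
move=> e1 /andP[s0 srho] Oz zy ws.
apply: (@argmin_ball_in (z + s *: e) (z + rho *: e)).
- by apply: (@ray_in _ _ rho) => //; rewrite s0.
- by apply: argmin_along_ray => //; rewrite s0 ltW.
- by rewrite ray_dist// distrC gtr0_norm ?subr_gt0.
Qed.

(** The point at distance [t] before the endpoint is the centre of a ball of radius [c * t] inside
    [Omega], so its distance to [o] is at least [r + c * t]. Squaring, dividing by [2 * t] and
    letting [t] tend to 0 gives the bound. *)
Lemma ray_transversal z e (rho r : R) o : enorm e = 1 -> Omega z -> 0 < rho ->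
  boundary_argmin Omega g z (z + rho *: e) -> 0 < r ->
  eball o r `&` Omega = set0 -> enorm (o - (z + rho *: e)) = r ->
  c * r <= dotp (o - (z + rho *: e)) e.
Proof.
move=> e1 Oz rho0 zy r0 or0 yr; set q := dotp _ _; have c0 := cone_slope_gt0.
have sep t : 0 < t <= rho -> c * r <= q + t / 2.
  move=> /andP[t0 trho]; pose p := z + (rho - t) *: e.
  have h : r + c * t <= enorm (p - o).
    rewrite leNgt; apply/negP => h.
    have rt0 : 0 < r + c * t by rewrite addr_gt0// mulr_gt0.
    (* [w] divides the segment from [o] to [p] in the ratio [r : c * t], so it would lie in both
       balls. *)
    pose k := r / (r + c * t); pose w := o + k *: (p - o).
    have k0 : 0 < k by rewrite divr_gt0.
    have k1 : k <= 1 by rewrite ler_pdivrMr// mul1r lerDl mulr_ge0 ?ltW.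
    have : (eball o r `&` Omega) w.
      split.
        rewrite /eball /= /w addrAC subrr add0r enormZ gtr0_norm//.
        rewrite /k mulrAC ltr_pdivrMr//; move: h.
        by rewrite -(ltr_pM2l r0).
      apply: (@ray_ball_in z e rho (rho - t)) => //; first by lra.
      rewrite -/p /w (_ : o + _ - p = (k - 1) *: (p - o)); last first.
        by apply/rowP => i; rewrite !mxE; ring.
      rewrite enormZ ler0_norm ?subr_le0// opprB opprB addrCA subrr addr0.
      have -> : 1 - k = c * t / (r + c * t) by rewrite /k; field; lra.
      rewrite mulrAC ltr_pdivrMr// ltr_pM2l// mulr_gt0//.
    by rewrite or0.
  have po : p - o = - (o - (z + rho *: e)) - t *: e.
    by apply/rowP => i; rewrite !mxE; ring.
  have {}h : (r + c * t) ^+ 2 <= enorm (p - o) ^+ 2.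
    have rt0 : 0 <= r + c * t by have := mulr_gt0 c0 t0; lra.
    by rewrite ler_sqr ?nnegrE ?enorm_ge0.
  have ee : dotp e e = 1 by rewrite -enorm_sqr e1 expr1n.
  have oo : dotp (o - (z + rho *: e)) (o - (z + rho *: e)) = r ^+ 2.
    by rewrite -enorm_sqr yr.
  have eo : dotp e (o - (z + rho *: e)) = q by rewrite dotpC.
  move: h; rewrite po enorm_sqr; move: (o - (z + rho *: e)) @q oo eo => n q oo eo.
  rewrite dotpDl !dotpDr !dotpNl !dotpNr !dotpZl !dotpZr ee oo eo -/q => h.
  have {}h : 0 <= t * (2 * q + t - 2 * r * c).
    have := sqr_ge0 (c * t); lra.
  by move: h; rewrite pmulr_rge0//; lra.
(* In place of a limit: a positive [t <= c * r - q] is incompatible with [c * r <= q + t / 2]. *)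
rewrite leNgt; apply/negP => qc.
have /sep : 0 < Num.min rho (c * r - q) <= rho.
  by rewrite lt_min rho0 subr_gt0 qc ge_min lexx.
have : Num.min rho (c * r - q) <= c * r - q by rewrite ge_min lexx orbT.
lra.
Qed.

End rays.

(** * Upper bound: semiconcavity at scale [h], uniform up to the boundary *)

Section semiconcavity.
Context {R : realType} {d : nat}.
Context (Omega : set 'rV[R]_d) (g : 'rV[R]_d -> R) (la k r : R).
Context (oO : open Omega) (la0 : 0 <= la) (la1 : la < 1).
Context (lg : elipschitz_on (closure Omega) la g).
Context (dg : forall x, Omega x -> differentiable g x).
Context (k0 : 0 <= k)
  (kg : forall x y, Omega x -> Omega y ->
     enorm (gradient g x - gradient g y) <= k * enorm (x - y)).
Context (r0 : 0 < r) (ball_out : uniform_exterior_ball Omega r).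
Implicit Types x y z e v w : 'rV[R]_d.
Local Notation c := (cone_slope la).

Lemma gradient_expansion a x y (s : R) : Omega a -> closure Omega x -> closure Omega y ->
  (forall t : R, 0 < t < 1 -> Omega (x + t *: (y - x)) /\
     enorm (x + t *: (y - x) - a) <= s) ->
  `|g y - g x - dotp (gradient g a) (y - x)| <= k * s * enorm (y - x).
Proof.
move=> Oa cx cy xyO.
have [t t01 ->] := gradient_MVT dg lg cx cy (fun t t01 => (xyO t t01).1).
rewrite -dotpNl -dotpDl; apply: le_trans (normr_dotp_le _ _) _.
rewrite ler_wpM2r ?enorm_ge0//; have [Oxy sxy] := xyO t t01.
by apply: le_trans (kg Oxy Oa) _; rewrite ler_wpM2l.
Qed.

(** The fraction times [2 * r * c * h ^+ 2] is [(h * (2 + 1 / c)) ^+ 2], the bound on the squared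
    displacement [b - y] in [semiconcave_at_scale]. The added 1 puts [b] strictly inside the
    exterior ball. *)
Definition exit_const : R := (2 + 1 / c) ^+ 2 / (2 * r * c) + 1.
Local Notation M := exit_const.

(** [2 * M] is the cost of the quadratic part of the exit time, at most doubled by the change of
    [g]. The three terms in [k] are the remainders of the expansions of [g] over [[a, y]],
    [[a, a + v]] and [[a + v, y']]. *)
Definition semiconcavity_const : R :=
  2 * M + k * ((2 / c) ^+ 2 + 1 + (3 / c + 2) * (3 / c + 1)).
Local Notation K := semiconcavity_const.

(** After positivity, the conditions ensure in turn that [a] lies on the segment, that the quadratic
    part [M * h ^+ 2] of the exit time is at most [h], and that the slope of [g] along [e] at [a] is
    at most 1 in absolute value. *)
Definition good_scale (rho h : R) :=
  [/\ 0 < h, 2 * h / c <= rho, M * h <= 1 & k * (2 * h / c) <= 1 - la].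

Lemma exit_const_ge1 : 1 <= M.
Proof.
have c0 := cone_slope_gt0 la0 la1.
by rewrite lerDr divr_ge0 ?sqr_ge0// mulr_ge0 ?(ltW c0)//; have := r0; lra.
Qed.

Lemma semiconcavity_const_ge0 : 0 <= K.
Proof.
have c0 := cone_slope_gt0 la0 la1; have M1 := exit_const_ge1.
have ci : 0 < c^-1 by rewrite invr_gt0.
rewrite /K addr_ge0//; first by lra.
rewrite mulr_ge0// addr_ge0//; first by rewrite addr_ge0// sqr_ge0.
by rewrite mulr_ge0//; lra.
Qed.

(* The competitor for [z + v] is the exit point of the ray from [a + v] in direction [e], where
   [a] lies on the segment at distance [2 * h / c] from [y]: the exterior ball stops this ray
   at a time that is linear in [v] up to [M * h ^+ 2], and [g] is expanded to first order at [a]. *)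
Lemma semiconcave_at_scale z e (rho h : R) : Omega z -> enorm e = 1 -> 0 < rho ->
  boundary_argmin Omega g z (z + rho *: e) -> good_scale rho h ->
  exists l : 'rV[R]_d, forall v, enorm v <= h ->
    exists2 y, boundary Omega y &
      enorm (z + v - y) + g y <= rho + g (z + rho *: e) + dotp l v + K * h ^+ 2.
Proof.
move=> Oz e1 rho0 zy [h0 hrho Mh kh].
have l0 := la0; have l1 := la1; have c0 := cone_slope_gt0 la0 la1.
have M1 := exit_const_ge1; have := r0 => r0'; have := k0 => k0'.
have ci : 0 < c^-1 by rewrite invr_gt0.
set eta := 2 * h / c in hrho kh.
have eta0 : 0 < eta by rewrite /eta divr_gt0// mulr_gt0.
have ee : dotp e e = 1 by rewrite -enorm_sqr e1 expr1n.
pose y := z + rho *: e; pose a := z + (rho - eta) *: e.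
have byy : boundary Omega y := zy.1.
have [ o [oO0 yr]] := ball_out byy.
have q1 := ray_transversal oO la0 la1 lg e1 Oz rho0 zy r0 oO0 yr.
rewrite -/y in q1 yr; set q := dotp (o - y) e in q1.
have q0 : 0 < q by apply: lt_le_trans q1; rewrite mulr_gt0.
pose N := y - o.
have Nr : enorm N = r by rewrite /N enorm_distC.
have Ne : dotp N e = - q by rewrite /N -opprB dotpNl.
have ya : y = a + eta *: e by apply/rowP => i; rewrite !mxE; ring.
have Oa : Omega a by apply: (ray_in oO la0 la1 lg e1 _ Oz zy); lra.
have Oball w : enorm (w - a) < c * eta -> Omega w.
  move=> wa; apply: (ray_ball_in oO la0 la1 lg (s := rho - eta) e1 _ Oz zy); first lra.
  by move: wa; rewrite -/a; congr (_ < _ * _); ring.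
have ceta : c * eta = 2 * h by rewrite /eta; field; lra.
pose G := gradient g a.
have cya : closure Omega y by case: byy.
have ca : closure Omega a by exact: subset_closure.
have E1 : `|g y - g a - eta * dotp G e| <= k * eta * eta.
  have := @gradient_expansion a a y eta Oa ca cya.
  have -> : y - a = eta *: e by rewrite ya addrC addKr.
  rewrite dotpZr enormZ e1 mulr1 (gtr0_norm eta0); apply=> t t01.
  rewrite (addrC a) addrK scalerA enormZ e1 mulr1.
  rewrite [X in Omega X](_ : _ = z + (rho - eta + t * eta) *: e); last first.
    by apply/rowP => i; rewrite !mxE; ring.
  have t0 : 0 < t * eta by rewrite mulr_gt0//; lra.
  have t1 : t * eta < eta by rewrite gtr_pMl//; lra.
  split; first by apply: (ray_in oO la0 la1 lg e1 _ Oz zy); lra.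
  by rewrite gtr0_norm// ltW.
(* The Lipschitz bound contributes [la * eta] and the expansion error at most [(1 - la) * eta].
   Hence, to first order, travelling further along [e] never lowers the total cost. *)
have Ge : `|dotp G e| <= 1.
  have ly : `|g y - g a| <= la * eta.
    have := lg cya ca; rewrite (_ : y - a = eta *: e); last by rewrite ya addrC addKr.
    by rewrite enormZ e1 mulr1 (gtr0_norm eta0).
  have : eta * `|dotp G e| <= eta * 1.
    rewrite -{1}(gtr0_norm eta0) -normrM mulr1.
    have h1 : k * eta * eta <= (1 - la) * eta by rewrite ler_wpM2r// ltW.
    have := ler_normB (g y - g a) (g y - g a - eta * dotp G e).
    by rewrite opprB addrC subrK; lra.
  by rewrite ler_pM2l.
have Ge0 : 0 <= 1 + dotp G e by move: Ge; rewrite ler_norml; lra.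
have Ge2 : 1 + dotp G e <= 2 by move: Ge; rewrite ler_norml; lra.
(* Linearized cost: the displacement [v] delays the meeting with the tangent plane of the exterior
   sphere at [y] by [dotp N v / q], paid at the rate [1 + dotp G e], and changes [g] directly by
   [dotp G v]. *)
exists (G + ((1 + dotp G e) / q) *: N) => v vh.
have v0 := enorm_ge0 v.
(* The first term solves [dotp N (v + tau *: e) = 0]; the second overcomes the curvature of the
   sphere, so that [b] enters the ball. *)
pose tau := dotp N v / q + M * h ^+ 2.
have Nvq : `|dotp N v / q| <= h / c.
  rewrite normrM normfV (gtr0_norm q0) ler_pdivrMr//.
  apply: le_trans (normr_dotp_le _ _) _; rewrite Nr.
  apply: (@le_trans _ _ (r * h)); first by rewrite ler_wpM2l// ltW.
  apply: (@le_trans _ _ (h / c * (c * r))); first by rewrite le_eqVlt; apply/orP; left; apply/eqP; field; lra.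
  by rewrite ler_wpM2l// divr_ge0; lra.
have Mh2 : M * h ^+ 2 <= h by rewrite expr2 mulrA ler_piMl// ltW.
have Mh20 : 0 <= M * h ^+ 2 by rewrite mulr_ge0 ?sqr_ge0//; lra.
have tau1 : tau <= h / c + h by move: Nvq; rewrite ler_norml /tau; lra.
have tau2 : - (h / c) <= tau by move: Nvq; rewrite ler_norml /tau; lra.
have etaE : eta = 2 * (h / c) by rewrite /eta mulrA.
have hc0 : 0 < h / c by rewrite divr_gt0.
pose b := y + v + tau *: e.
have nOb : ~ Omega b.
  move=> Ob; suff : (eball o r `&` Omega) b by rewrite oO0.
  split=> //; rewrite /eball /= enorm_lt; last exact: ltW.
  pose w := v + tau *: e.
  have wh : enorm w <= h * (2 + 1 / c).
    apply: le_trans (ler_enormD _ _) _; rewrite enormZ e1 mulr1.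
    have : `|tau| <= h / c + h by rewrite ler_norml; lra.
    have -> : h * (2 + 1 / c) = h / c + h + h by field; lra.
    by lra.
  have -> : b - o = N + w by rewrite /b /N /w; apply/rowP => i; rewrite !mxE; ring.
  have Nw : dotp N w = - q * M * h ^+ 2.
    by rewrite /w dotpDr dotpZr Ne /tau; field; lra.
  have ww : dotp w w <= 2 * r * c * (M - 1) * h ^+ 2.
    rewrite -enorm_sqr; apply: (@le_trans _ _ ((h * (2 + 1 / c)) ^+ 2)).
      by rewrite ler_sqr ?nnegrE ?enorm_ge0// mulr_ge0 ?(ltW h0)// mul1r; lra.
    rewrite le_eqVlt; apply/orP; left; apply/eqP; rewrite /M; field; lra.
  have NN : dotp N N = r ^+ 2 by rewrite -enorm_sqr Nr.
  move: (N) (w) NN Nw ww => N' w' NN Nw ww.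
  rewrite dotpDl !dotpDr (dotpC w' N') Nw NN.
  have h2 : 0 < h ^+ 2 by rewrite exprn_gt0.
  have : (c * r) * (M * h ^+ 2) <= q * (M * h ^+ 2) by rewrite ler_wpM2r.
  have : 0 < 2 * r * c * h ^+ 2 by rewrite pmulr_lgt0// pmulr_lgt0// pmulr_lgt0.
  by move: ww; move: (c) (M) => c1 M2; lra.
have Oav : Omega (a + v).
  by apply: Oball; rewrite addrAC subrr add0r ceta; lra.
(* The points [z + v], [a + v] and the exit point lie on one line of direction [e], so the travelled
   length is exactly [rho - eta + L], with no quadratic error. *)
have [t /andP[t0 t1] [by' hy']] := segment_exit oO Oav nOb.
have bav : b - (a + v) = (tau + eta) *: e.
  by rewrite /b ya; apply/rowP => i; rewrite !mxE; ring.
rewrite bav scalerA in by' hy'.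
set L := t * (tau + eta) in by'.
have te0 : 0 <= tau + eta by lra.
have L0 : 0 <= L by rewrite mulr_ge0// ltW.
have L1 : L <= tau + eta by rewrite /L ler_piMl.
pose y' := a + v + L *: e; rewrite -/y' in by'.
exists y' => //.
have -> : enorm (z + v - y') = rho - eta + L.
  have -> : z + v - y' = - ((rho - eta + L) *: e).
    by rewrite /y'; apply/rowP => i; rewrite !mxE; ring.
  by rewrite enormN enormZ e1 mulr1 ger0_norm; lra.
have cav : closure Omega (a + v) by exact: subset_closure.
have cy' : closure Omega y' by case: by'.
have E2 : `|g (a + v) - g a - dotp G v| <= k * h ^+ 2.
  have := @gradient_expansion a a (a + v) h Oa ca cav.
  rewrite (_ : a + v - a = v); last by rewrite addrC addKr.
  move=> H; apply: (le_trans (H _)) => [s s01|]; last first.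
    by rewrite expr2 mulrA ler_wpM2l// mulr_ge0// ltW.
  have sv : enorm (a + s *: v - a) <= enorm v.
    rewrite addrAC subrr add0r enormZ gtr0_norm ?ler_piMl//; lra.
  by split; [apply: Oball; rewrite ceta|]; lra.
have E3 : `|g y' - g (a + v) - L * dotp G e| <= k * (h + L) * L.
  have := @gradient_expansion a (a + v) y' (h + L) Oa cav cy'.
  have -> : y' - (a + v) = L *: e by rewrite /y' addrC addKr.
  rewrite dotpZr enormZ e1 mulr1 (ger0_norm L0); apply=> s s01; rewrite scalerA; split.
    have := hy' (s * t); rewrite ?bav ?scalerA /L mulrA; apply.
    by rewrite mulr_ge0 ?(ltW t0) ?gtr_pMl//; lra.
  have -> : a + v + (s * L) *: e - a = v + (s * L) *: e.
    by apply/rowP => i; rewrite !mxE; ring.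
  apply: le_trans (ler_enormD _ _) _.
  rewrite enormZ e1 mulr1 ger0_norm; last by rewrite mulr_ge0//; lra.
  by rewrite lerD// ler_piMl//; lra.
have Lh : L <= h * (3 / c + 1).
  have -> : h * (3 / c + 1) = h / c + h + 2 * (h / c) by field; lra.
  lra.
have E3' : k * (h + L) * L <= k * ((3 / c + 2) * (3 / c + 1)) * h ^+ 2.
  rewrite -!mulrA ler_wpM2l//.
  have -> : (3 / c + 2) * ((3 / c + 1) * h ^+ 2) = (h + h * (3 / c + 1)) * (h * (3 / c + 1)) by ring.
  by apply: ler_pM => //; lra.
have E1' : k * eta * eta = k * (2 / c) ^+ 2 * h ^+ 2 by rewrite /eta; field; lra.
(* The sign of [1 + dotp G e] allows the unknown [L] to be replaced by its upper bound. *)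
have T1 : (L - eta) * (1 + dotp G e) <= tau * (1 + dotp G e) by rewrite ler_wpM2r//; lra.
have T2 : tau * (1 + dotp G e) <= (1 + dotp G e) / q * dotp N v + 2 * M * h ^+ 2.
  rewrite /tau mulrDl; apply: lerD; first by rewrite le_eqVlt; apply/orP; left; apply/eqP; field; lra.
  have := ler_wpM2r Mh20 Ge2; lra.
rewrite dotpDl dotpZl -/y /K.
move: E1 E2 E3; rewrite !ler_norml => /andP[E1 _] /andP[_ E2] /andP[_ E3].
move: ((1 + dotp G e) / q * dotp N v) T2 => X T2.
rewrite E1' in E1.
move: (h ^+ 2) (dotp G v) (dotp G e) (3 / c) (2 / c) T1 T2 E3' E3 E2 E1 => h2 Gv Ge' c3 c2.
by move: (M) => M' *; lra.
Qed.

End semiconcavity.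

(** * Lower bound, and the Lipschitz inverse of the flow along the segments *)

Section inverse_lipschitz.
Context {R : realType} {d : nat}.
Context (Omega : set 'rV[R]_d) (g : 'rV[R]_d -> R) (la k r : R).
Context (oO : open Omega) (la0 : 0 <= la) (la1 : la < 1).
Context (lg : elipschitz_on (closure Omega) la g).
Context (dg : forall x, Omega x -> differentiable g x).
Context (k0 : 0 <= k)
  (kg : forall x y, Omega x -> Omega y ->
     enorm (gradient g x - gradient g y) <= k * enorm (x - y)).
Context (r0 : 0 < r) (ball_out : uniform_exterior_ball Omega r).
Implicit Types x y z e v w : 'rV[R]_d.
Local Notation K := (semiconcavity_const la k r).

(** Minimality at [x], the triangle inequality through [w], and [enormDZ_le] for the distance from
    [x] to [w]. It holds for every boundary point [y], hence for the competitor supplied by the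
    upper bound. *)
Lemma argmin_lower x e (rho s : R) w y : enorm e = 1 -> 0 < s <= rho ->
  boundary_argmin Omega g x (x + rho *: e) -> boundary Omega y ->
  rho - s + g (x + rho *: e) - dotp e (w - (x + s *: e))
    - enorm (w - (x + s *: e)) ^+ 2 / (2 * s) <= enorm (w - y) + g y.
Proof.
move=> e1 /andP[s0 sr] [_ h] /h.
rewrite ray_dist0// ger0_norm; last by lra.
have := ler_enorm_dist w x y; rewrite (enorm_distC x w).
have := enormDZ_le (w - (x + s *: e)) s0 e1.
have -> : s *: e + (w - (x + s *: e)) = w - x by apply/rowP => i; rewrite !mxE; ring.
lra.
Qed.

(* The upper bound at [z1 = x1 + s e1] and the two lower bounds [argmin_lower] pinch the slopes:
   [s * enorm (e1 - e2)] is of order [h], with a constant bounded for bounded [s]. Only [z1] needs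
   to be at a controlled distance from the boundary. *)
Definition inverse_lipschitz_const (D : R) : R := 4 * K * D + 5.

Lemma ray_inverse_lipschitz x1 x2 e1 e2 (rho1 rho2 s h D : R) :
  Omega x1 -> Omega x2 -> enorm e1 = 1 -> enorm e2 = 1 ->
  0 < s < rho1 -> s <= rho2 -> s <= D ->
  boundary_argmin Omega g x1 (x1 + rho1 *: e1) ->
  boundary_argmin Omega g x2 (x2 + rho2 *: e2) ->
  good_scale la k r (rho1 - s) h ->
  2 * enorm (x2 + s *: e2 - (x1 + s *: e1)) <= h ->
  enorm (x1 - x2) <= inverse_lipschitz_const D * h.
Proof.
move=> O1 O2 n1 n2 /andP[s0 s1] s2 sD a1 a2 gh.
have [h0 _ _ _] := gh.
pose z1 := x1 + s *: e1; pose z2 := x2 + s *: e2.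
rewrite -/z1 -/z2; set v0 := z2 - z1 => v0h.
have K0 : 0 <= K := semiconcavity_const_ge0 la0 la1 k0 r0.
have Oz1 : Omega z1 by apply: (ray_in oO la0 la1 lg n1 _ O1 a1); rewrite (ltW s0).
have z1y : z1 + (rho1 - s) *: e1 = x1 + rho1 *: e1.
  by apply/rowP => i; rewrite !mxE; ring.
have az1 : boundary_argmin Omega g z1 (z1 + (rho1 - s) *: e1).
  by rewrite z1y; apply: (argmin_along_ray n1 _ a1); rewrite !ltW.
have [|l hl] := semiconcave_at_scale oO la0 la1 lg dg k0 kg r0 ball_out Oz1 n1 _ az1 gh.
  by rewrite subr_gt0.
rewrite z1y in hl.
have s1' : 0 < s <= rho1 by rewrite s0 ltW.
have s2' : 0 < s <= rho2 by rewrite s0.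
have is0 : 0 < s^-1 by rewrite invr_gt0.
have sqh (a : 'rV[R]_d) (b : R) : 0 <= b -> enorm a <= b * h -> enorm a ^+ 2 / (2 * s) <= b ^+ 2 / 2 * (h ^+ 2 / s).
  move=> b0 ab; rewrite [leRHS](_ : _ = (b * h) ^+ 2 / (2 * s)); last by field; lra.
  by rewrite ler_wpM2r ?invr_ge0 ?mulr_ge0 ?(ltW s0)// ler_sqr ?nnegrE ?enorm_ge0// mulr_ge0// ltW.
set Q := h ^+ 2 / s in sqh.
(* The two bounds at [z1 + v] concern the same [y] and their constants cancel, so [l] is close to
   [- e1]. *)
have S1 v : enorm v <= h -> - (K * h ^+ 2 + Q / 2) <= dotp (l + e1) v.
  move=> vh; have [y by_ Hy] := hl v vh.
  have := argmin_lower (z1 + v) n1 s1' a1 by_.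
  rewrite -/z1 (addrC z1 v) addrK; rewrite (addrC z1 v) in Hy.
  have := sqh v 1; rewrite mul1r => /(_ ler01 vh).
  by rewrite dotpDl; lra.
(* The lower bound from the first ray, at the point [z2] and for the endpoint of the second ray. *)
have S2 : rho1 - s + g (x1 + rho1 *: e1) - dotp e1 v0 - Q / 8 <=
    rho2 - s + g (x2 + rho2 *: e2).
  have [by2 _] := a2.
  have := argmin_lower z2 n1 s1' a1 by2.
  rewrite -/z1 -/v0 ray_dist// ler0_norm; last by lra.
  have v0h' : enorm v0 <= 1 / 2 * h by lra.
  have := sqh v0 (1 / 2) _ v0h'; rewrite divr_ge0//.
  by move=> /(_ isT); lra.
(* The lower bound from the second ray meets the upper bound at [z1 + v]; [S1] at [- v] eliminates
   [l] and [S2] the constants. The multiples of [Q] add up to [1/2 + 1/8 + 9/8 <= 2]. *)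
have S3 v : enorm v <= h -> - (2 * K * h ^+ 2 + 2 * Q) <= dotp (e2 - e1) (v - v0).
  move=> vh; have [y by_ Hy] := hl v vh.
  have := argmin_lower (z1 + v) n2 s2' a2 by_.
  rewrite -/z2 (_ : z1 + v - z2 = v - v0); last first.
    by rewrite /v0; apply/rowP => i; rewrite !mxE; ring.
  have vv : enorm (v - v0) <= 3 / 2 * h.
    by apply: le_trans (ler_enormD _ _) _; rewrite enormN; lra.
  have := sqh (v - v0) (3 / 2) _ vv; rewrite divr_ge0//.
  have := S1 (- v); rewrite enormN => /(_ vh); rewrite dotpNr dotpDl.
  have Q0 : 0 <= Q by rewrite /Q divr_ge0 ?sqr_ge0// ltW.
  rewrite (dotpDl e2) dotpNl (dotpDr _ _ e1) dotpNr.
  by move=> H1 /(_ isT) H2 H3; lra.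
have ee : s * enorm (e2 - e1) <= (4 * K * D + 4) * h.
  have [->|e12] := eqVneq (e2 - e1) 0.
    rewrite enorm0 mulr0 mulr_ge0// ?(ltW h0)// addr_ge0// !mulr_ge0//; lra.
  have N0 : 0 < enorm (e2 - e1) by rewrite enorm_gt0.
  set N := enorm (e2 - e1) in N0 *.
  (* From [v0], a step of length [h / 2] against [e2 - e1]; it stays in the ball of radius [h]
     because [enorm v0 <= h / 2]. *)
  pose v := v0 - (h / 2 / N) *: (e2 - e1).
  have vh : enorm v <= h.
    apply: le_trans (ler_enormD _ _) _.
    rewrite enormN enormZ -/N ger0_norm; last by rewrite !divr_ge0// ltW.
    by rewrite divfK ?gt_eqF//; lra.
  have := S3 v vh; rewrite /v addrAC subrr add0r dotpNr dotpZr -enorm_sqr -/N.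
  have -> : h / 2 / N * N ^+ 2 = h * (N / 2) by field; lra.
  rewrite (_ : 2 * K * h ^+ 2 + 2 * Q = h * ((2 * K + 2 / s) * h)); last by rewrite /Q; field; lra.
  rewrite lerN2 ler_pM2l// => H.
  have : s * (N / 2) <= s * ((2 * K + 2 / s) * h) by rewrite ler_wpM2l// ltW.
  rewrite (_ : s * ((2 * K + 2 / s) * h) = 2 * K * s * h + 2 * h); last by field; lra.
  have : K * s * h <= K * D * h by rewrite ler_wpM2r ?(ltW h0)// ler_wpM2l.
  lra.
have -> : x1 - x2 = - v0 + s *: (e2 - e1).
  by rewrite /v0 /z1 /z2; apply/rowP => i; rewrite !mxE; ring.
apply: le_trans (ler_enormD _ _) _; rewrite enormN enormZ (gtr0_norm s0).
by rewrite /inverse_lipschitz_const; lra.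
Qed.

End inverse_lipschitz.

(** * Outer regularity of finite Borel measures *)

Lemma cvge0_lt (R : realType) (u : nat -> \bar R) (e : R) :
  u @ \oo --> 0%E -> 0 < e -> exists n, (u n < e%:E)%E.
Proof.
move=> /fine_cvgP[fu /cvgrPdist_lt ue] e0.
near \oo => n; exists n.
have un : u n \is a fin_num by near: n.
rewrite -(fineK un) lte_fin; apply: le_lt_trans (ler_norm _) _.
by rewrite -normrN -[X in `|X|]add0r; near: n; exact: ue.
Unshelve. all: by end_near. Qed.

(** A witness [y] outside [A] remains one for nearby centres, whatever [A] is. This makes the
    condition that a ball fits into a set Borel. *)
Lemma closed_erosion (R : realType) d (A : set 'rV[R]_d) (e : R) :
  closed [set x | forall y, enorm (y - x) < e -> A y].
Proof.
rewrite -[X in closed X]setCK; apply: open_closedC; apply/open_enormP => x /existsNP[y].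
move=> /not_implyP[yx nAy].
exists (e - enorm (y - x)); first by rewrite subr_gt0.
move=> w wx; apply/existsNP; exists y; apply/not_implyP; split=> //.
have := ler_enorm_dist x y w; rewrite (enorm_distC x w).
by move=> h; apply: le_lt_trans h _; rewrite addrC -ltrBrDr.
Qed.

Section regularity.
Context {R : realType} {d : nat} (m : {measure set 'rV[R]_d -> \bar R}).
Hypothesis mfin : (m setT < +oo)%E.
Implicit Types A F U : set 'rV[R]_d.

(** Inner approximation by closed sets is included to make the property stable under complements, so
    that it defines a sigma-algebra. *)
Let regular A := measurable A /\ forall e : R, 0 < e -> exists F U,
  [/\ closed F, open U, F `<=` A, A `<=` U & (m (U `\` F) < e%:E)%E].

Let mfin' A : measurable A -> (m A < +oo)%E.
Proof. by move=> mA; apply: le_lt_trans mfin; rewrite le_measure ?inE. Qed.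

Let regular_open A : open A -> regular A.
Proof.
move=> oA; have mA := rV_open_measurable oA; split=> // e e0.
pose F n := [set x | forall y, enorm (y - x) < n.+1%:R^-1 :> R -> A y].
have cF n : closed (F n) by exact: closed_erosion.
have : m (A `\` F n) @[n --> \oo] --> 0%E.
  rewrite -(measure0 m) (_ : set0 = \bigcap_n (A `\` F n)).
    apply: nonincreasing_cvg_mu => //.
    - by apply: mfin'; apply: measurableD => //; exact: rV_closed_measurable.
    - by move=> n; apply: measurableD => //; exact: rV_closed_measurable.
    - apply: bigcap_measurable => // n _.
      by apply: measurableD => //; exact: rV_closed_measurable.
    - move=> i j ij; apply/subsetPset => x [Ax nF]; split=> //; apply: contra_not nF => Fi y yx.
      apply: Fi; apply: lt_le_trans yx _; by rewrite lef_pV2 ?posrE// ler_nat.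
  apply/esym; rewrite -subset0 => x /= H.
  have [Ax _] := H 0%N I.
  move/open_enormP : (oA) => /(_ _ Ax)[e' e'0 eA].
  have [_] := H (Num.truncn e'^-1) I; apply=> y yx; apply: eA.
  apply: lt_trans yx _; rewrite -[ltRHS]invrK ltf_pV2 ?posrE ?invr_gt0//.
  exact: truncnS_gt.
move=> /cvge0_lt/(_ e0)[n ne]; exists (F n), A; split=> // x Fx.
by apply: Fx; rewrite subrr enorm0.
Qed.

Let regular_setC A : regular A -> regular (~` A).
Proof.
move=> [mA h]; split=> [|e /h[F [U [cF oU FA AU e0]]]]; first exact: measurableC.
exists (~` U), (~` F); split.
- exact: open_closedC.
- exact: closed_openC.
- exact: subsetC.
- exact: subsetC.
- by rewrite setDE setCK setIC -setDE.
Qed.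

Let regular_bigcup (A : (set 'rV[R]_d)^nat) :
  (forall n, regular (A n)) -> regular (\bigcup_n A n).
Proof.
move=> h; have mA n : measurable (A n) by case: (h n).
split=> [|e e0]; first exact: bigcup_measurable.
have en n : 0 < e / 2 / (2 ^ n.+1)%:R by rewrite !divr_gt0// ltr0n expn_gt0.
have /choice[FU HFU] n : exists FU : set 'rV[R]_d * set 'rV[R]_d,
    [/\ closed FU.1, open FU.2, FU.1 `<=` A n, A n `<=` FU.2 &
      (m (FU.2 `\` FU.1) < (e / 2 / (2 ^ n.+1)%:R)%:E)%E].
  by have [_ /(_ _ (en n))[F [U H]]] := h n; exists (F, U).
pose F n := (FU n).1; pose U n := (FU n).2.
have cF n : closed (F n) by case: (HFU n).
have oU n : open (U n) by case: (HFU n).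
have FA n : F n `<=` A n by case: (HFU n).
have AU n : A n `<=` U n by case: (HFU n).
have mF n : measurable (F n) by exact: rV_closed_measurable.
have mU n : measurable (U n) by exact: rV_open_measurable.
have mbU : measurable (\bigcup_n U n) by exact: bigcup_measurable.
pose G n := \bigcup_(i < n.+1) F i.
have mG n : measurable (G n) by exact: bigcup_measurable.
have d1 : (m (\bigcup_n U n `\` \bigcup_n F n) <= (e / 2)%:E)%E.
  apply: (@le_trans _ _ (\sum_(0 <= i <oo) m (U i `\` F i))%E).
    apply: measure_sigma_subadditive.
    - by move=> n; exact: measurableD.
    - by apply: measurableD => //; exact: bigcup_measurable.
    - move=> x [[n _ Ux] nF]; exists n => //; split=> // Fx; apply: nF.
      by exists n.
  apply: (@le_trans _ _ (\sum_(0 <= i <oo) (0 + (e / 2 / (2 ^ i.+1)%:R)%:E))%E).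
    by apply: lee_nneseries => // n _; rewrite add0e; have [_ _ _ _ /ltW] := HFU n.
  apply: le_trans (@epsilon_trick R (fun=> 0%E) (e / 2) xpredT _ _) _ => //.
    by rewrite divr_ge0// ltW.
  by rewrite eseries0// add0e.
(* The union of all [F n] need not be closed, so it is cut at a finite rank; the loss tends to 0
   because [m] is finite. *)
have d2 : (m (\bigcup_n F n `\` G n)) @[n --> \oo] --> 0%E.
  rewrite -(measure0 m) (_ : set0 = \bigcap_n (\bigcup_n F n `\` G n)).
    apply: nonincreasing_cvg_mu => //.
    - by apply: mfin'; apply: measurableD => //; exact: bigcup_measurable.
    - by move=> n; apply: measurableD => //; exact: bigcup_measurable.
    - apply: bigcap_measurable => // n _.
      by apply: measurableD => //; exact: bigcup_measurable.
    - move=> i j ij; apply/subsetPset => x [Fx nG]; split=> //.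
      apply: contra_not nG => -[k /= ki Fk]; exists k => //=.
      by rewrite (leq_trans ki).
  apply/esym; rewrite -subset0 => x /= H.
  have [[n _ Fn] _] := H 0%N I.
  by have [_] := H n I; apply; exists n => //=.
have e20 : 0 < e / 2 by rewrite divr_gt0.
have [n ne] := cvge0_lt d2 e20.
exists (G n), (\bigcup_n U n); split.
- by rewrite /G bigcup_mkord; apply: closed_bigsetU => i _; exact: cF.
- exact: bigcup_open.
- by move=> x [i /= _ Fx]; exists i => //; exact: FA.
- by move=> x [i _ Ax]; exists i => //; exact: AU.
- apply: (@le_lt_trans _ _ (m (\bigcup_n U n `\` \bigcup_n F n) + m (\bigcup_n F n `\` G n))%E).
    apply: le_trans (measureU2 _ _ _); last 2 first.
    - by apply: measurableD => //; exact: bigcup_measurable.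
    - by apply: measurableD => //; exact: bigcup_measurable.
    rewrite le_measure ?inE//.
    - exact: measurableD.
    - by apply: measurableU; apply: measurableD => //; exact: bigcup_measurable.
    - move=> x [Ux nG]; have [Fx|nFx] := pselect ((\bigcup_n F n) x).
        by right.
      by left.
  by rewrite (splitr e) EFinD; apply: lee_ltD; rewrite ?ge0_fin_numE ?mfin'//; apply: measurableD => //; exact: bigcup_measurable.
Qed.

Lemma outer_regular A (e : R) : measurable A -> 0 < e ->
  exists U, [/\ open U, A `<=` U & (m (U `\` A) < e%:E)%E].
Proof.
move=> mA e0; suff [_ /(_ _ e0)[F [U [cF oU FA AU h]]]] : regular A.
  exists U; split=> //; apply: le_lt_trans h; rewrite le_measure ?inE//.
  - by apply: measurableD => //; exact: rV_open_measurable.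
  - apply: measurableD; first exact: rV_open_measurable.
    exact: rV_closed_measurable.
  - exact: setDS.
move: A mA; apply: smallest_sub => [|A]; last exact: regular_open.
split.
- by apply: regular_open; exact: open0.
- by move=> A; rewrite setTD; exact: regular_setC.
- exact: regular_bigcup.
Qed.

End regularity.

(** * Measurability of vector-valued maps *)

Section measurable_row_vector.
Context {R : realType} {dsp : measure_display} {X : measurableType dsp} {d : nat}.
Implicit Types (D : set X).

Lemma measurable_rV_funP D (f : X -> 'rV[R]_d) : measurable D ->
  (forall i, measurable_fun D (fun x => f x ord0 i)) -> measurable_fun D f.
Proof.
move=> mD mf; apply: (@measurability _ _ _ _ _ _ (@open 'rV[R]_d)) => // _ [A oA <-].
rewrite (rV_bigcup_rat oA) preimage_bigcup setI_bigcupr.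
apply: countable_bigcupT_measurable; first exact: countableP.
move=> [q k]/=.
have [qA|qA] := pselect (ball (rV_ratr q) k.+1%:R^-1 `<=` A); last first.
  rewrite [X in measurable X](_ : _ = set0)//.
  by apply/seteqP; split=> [x [_ []]|x].
rewrite [X in measurable X](_ : _ = D `&` \bigcap_(i in [set: 'I_d])
    (D `&` (fun x => f x ord0 i) @^-1` ball (rV_ratr q ord0 i) k.+1%:R^-1)).
  apply: measurableI => //; apply: fin_bigcap_measurable => // i _.
  by apply: mf => //; apply: open_measurable; exact: ball_open.
apply/seteqP; split=> x /=.
  by move=> [Dx [_ [_ h]]]; split=> // i _; split=> //; exact: h.
move=> [Dx h]; split=> //; split=> //; split; first by rewrite invr_gt0.
by move=> i j; rewrite (ord1 i); have [] := h j I.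
Qed.

Lemma measurable_rV_coordT (D : set X) (f : X -> 'rV[R]_d) i :
  measurable_fun D f -> measurable_fun D (fun x => f x ord0 i).
Proof. by move=> mf; apply: (measurableT_comp (measurable_rV_coord i)). Qed.

Lemma measurable_enorm D (f : X -> 'rV[R]_d) :
  measurable_fun D f -> measurable_fun D (fun x => enorm (f x)).
Proof.
move=> mf; rewrite /enorm.
apply: (@measurableT_comp _ _ _ _ _ _ (@Num.sqrt R)).
  by apply: continuous_measurable_fun; exact: sqrt_continuous.
apply: measurable_sum => i; apply: measurable_funX.
exact: measurable_rV_coordT.
Qed.

(** The inverse is the power of exponent -1, also at zero, where both vanish. *)
Lemma measurable_funV_gt0 D (f : X -> R) : measurable D ->
  (forall x, D x -> 0 <= f x) -> measurable_fun D f ->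
  measurable_fun D (fun x => (f x)^-1).
Proof.
move=> mD f0 mf; apply: (eq_measurable_fun (fun x => f x `^ (-1))).
  by move=> x; rewrite inE => Dx; rewrite powR_inv1 ?f0.
exact: (measurableT_comp (measurable_powR _)).
Qed.

End measurable_row_vector.

(** * Grid covering in place of a change of variables *)

Section covering.
Context {R : realType} {d : nat}.
Local Notation mu := (rV_lebesgue R d).

Lemma rV_lebesgue_diam_le (F : set 'rV[R]_d) (b : R) x0 : 0 <= b ->
  measurable F -> (forall x, F x -> enorm (x - x0) <= b) ->
  (mu F <= ((2 * b) ^+ d)%:E)%E.
Proof.
move=> b0 mF Fb; pose lo : 'rV[R]_d := x0 - const_mx b; pose hi := x0 + const_mx b.
have lohi i : lo ord0 i <= hi ord0 i by rewrite !mxE; lra.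
have := rV_lebesgue_box lohi.
rewrite (eq_bigr (fun=> 2 * b)); last by move=> i _; rewrite !mxE; ring.
rewrite prodr_const card_ord => <-; apply: le_measure; rewrite ?inE//.
  exact: rV_box_measurable.
move=> x /Fb xb i /=; rewrite !mxE.
have := le_trans (normr_coord_le _ i) xb; rewrite !mxE ler_norml; lra.
Qed.

Definition grid_cell (a : R) (x : 'rV[R]_d) : 'rV[int]_d :=
  \row_i Num.floor (x ord0 i / a).

Lemma grid_cellP (a : R) x y : 0 < a ->
  grid_cell a x = grid_cell a y <->
  forall i, a * (Num.floor (x ord0 i / a))%:~R <= y ord0 i <
            a * (Num.floor (x ord0 i / a) + 1)%:~R.
Proof.
move=> a0; split=> [/rowP xy i|h].
  have := floor_itv (y ord0 i / a); have := xy i; rewrite !mxE => <-.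
  by rewrite ler_pdivlMr// ltr_pdivrMr// ![a * _]mulrC.
apply/rowP => i; rewrite !mxE; apply/esym/floor_def.
by rewrite ler_pdivlMr// ltr_pdivrMr// ![_ * a]mulrC.
Qed.

(* A half-open cell of side [a] contains a closed box of side [a / 2]: the crude lower bound on its
   volume suffices since constants do not matter. *)
Lemma grid_cover_le (F U : set 'rV[R]_d) (S : 'rV[R]_d -> 'rV[R]_d) (h L : R) :
  0 < h -> 0 <= L -> measurable F -> measurable_fun F S -> measurable U ->
  (forall x1 x2, F x1 -> F x2 -> 2 * enorm (S x2 - S x1) <= h -> enorm (x1 - x2) <= L * h) ->
  (forall x w, F x -> enorm (w - S x) < h -> U w) ->
  (mu F <= ((8 * L * d.+1%:R) ^+ d)%:E * mu U)%E.
Proof.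
move=> h0 L0 mF mS mU FL FU.
(* Cells of this side have Euclidean diameter at most [h / 2], so two images in one cell satisfy the
   premise of the Lipschitz hypothesis. *)
pose a := h / 2 / d.+1%:R; have a0 : 0 < a by rewrite /a !divr_gt0.
have cell_dist x y : grid_cell a x = grid_cell a y -> 2 * enorm (x - y) <= h.
  move=> /grid_cellP xy; have {}xy := xy a0.
  have : `|x - y| <= a.
    rewrite [X in X <= _]mx_normrE; apply: bigmax_le; first exact: ltW.
    move=> -[i j] _ /=; rewrite (ord1 i) !mxE.
    have := xy j; have /grid_cellP := erefl (grid_cell a x); move=> /(_ a0 j).
    by rewrite rmorphD/= ler_norml; lra.
  move=> xya; have := enorm_le_normr (x - y).
  have : d%:R * `|x - y| <= d.+1%:R * a by apply: ler_pM => //; rewrite ler_nat.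
  have -> : d.+1%:R * a = h / 2 by rewrite /a mulrC divfK.
  lra.
(* Numbering the cells turns the decompositions of [F] and [U] into countable disjoint unions,
   compared term by term. *)
pose code x := pickle (grid_cell a x); pose E n := [set x | code x = n].
have code_eq x y : code x = code y -> grid_cell a x = grid_cell a y.
  exact: (pcan_inj pickleK).
have cellE x : E (code x) = \bigcap_(i in [set: 'I_d]) (fun y : 'rV[R]_d => y ord0 i) @^-1`
    `[a * (Num.floor (x ord0 i / a))%:~R, a * (Num.floor (x ord0 i / a) + 1)%:~R[.
  apply/seteqP; split=> [y /esym/code_eq/grid_cellP xy i _|y xy].
    by rewrite /= in_itv/=; exact: xy.
  rewrite /E /=; congr pickle; apply/esym/grid_cellP => // i.
  by have := xy i I; rewrite /= in_itv.
have mE n : measurable (E n).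
  have [[x <-]|nE] := pselect (exists x, code x = n); last first.
    by rewrite (_ : E n = set0)// -subset0 => x Ex; apply: nE; exists x.
  rewrite cellE; apply: fin_bigcap_measurable => // i _.
  by rewrite -[X in measurable X]setTI; apply: measurable_rV_coord.
pose Fn n := F `&` S @^-1` E n.
have mFn n : measurable (Fn n) by exact: mS.
have trE (A : nat -> set 'rV[R]_d) (q : 'rV[R]_d -> nat) :
    (forall n x, A n x -> q x = n) -> trivIset setT A.
  by move=> Aq; apply/trivIsetP => i j _ _ ij; rewrite -subset0 => x [/Aq + /Aq]; move=> -> /eqP; rewrite (negbTE ij).
have bF : F = \bigcup_n Fn n.
  by apply/seteqP; split=> [x Fx|x [n _ []]//]; exists (code (S x)).
have bU : U = \bigcup_n (U `&` E n).
  by apply/seteqP; split=> [x Ux|x [n _ []]//]; exists (code x).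
rewrite bF measure_bigcup//; last first.
  by apply: (trE _ (code \o S)) => n x [].
rewrite [X in (_ * mu X)%E]bU measure_bigcup//; last 2 first.
  by move=> n _; exact: measurableI.
  by apply: (trE _ code) => n x [].
rewrite -nneseriesZl//; apply: lee_nneseries => // n _.
have [[x0 [Fx0 Ex0]]|Fn0] := pselect (exists x, Fn n x); last first.
  rewrite (_ : Fn n = set0) ?measure0 ?mule_ge0//; last first.
    by rewrite -subset0 => x Fx; apply: Fn0; exists x.
  by rewrite lee_fin exprn_ge0// !mulr_ge0.
(* A cell that meets the image of [F] lies entirely in [U], so its whole volume is available for the
   comparison. *)
have EU : E n `<=` U.
  move=> w Ew; apply: (FU x0) => //; have : code w = code (S x0) by rewrite Ew Ex0.
  by move=> /code_eq/cell_dist; have := enorm_ge0 (w - S x0); have := h0; lra.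
rewrite (setIidr EU).
apply: (@le_trans _ _ ((2 * (L * h)) ^+ d)%:E).
  apply: (@rV_lebesgue_diam_le _ _ x0) => //; first by rewrite mulr_ge0// ltW.
  move=> x [Fx Ex]; apply: FL => //; apply: cell_dist; apply: code_eq.
  by rewrite Ex0 Ex.
(* [a / 2] is [h / (4 * d.+1)], the side of the box inside the cell; this is where the 8 comes
   from. *)
have -> : 2 * (L * h) = 8 * L * d.+1%:R * (a / 2).
  have : (d.+1%:R : R) != 0 by rewrite pnatr_eq0.
  by rewrite /a; move: (d.+1%:R : R) => D D0; field.
rewrite exprMn EFinM; apply: lee_wpmul2l; first by rewrite lee_fin exprn_ge0// !mulr_ge0.
pose lo : 'rV[R]_d := \row_i (a * (Num.floor (S x0 ord0 i / a))%:~R).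
pose hi : 'rV[R]_d := lo + const_mx (a / 2).
have lohi i : lo ord0 i <= hi ord0 i by rewrite !mxE; lra.
have := rV_lebesgue_box lohi.
rewrite (eq_bigr (fun=> a / 2)); last by move=> i _; rewrite !mxE; ring.
rewrite prodr_const card_ord => <-; apply: le_measure; rewrite ?inE//.
  exact: rV_box_measurable.
rewrite -Ex0 cellE => x /= xb i _; have := xb i; rewrite !mxE /= in_itv/= rmorphD/=.
lra.
Qed.

End covering.

(** * Size and measure bounds from the boundedness of the domain *)

Section bounded.
Context {R : realType} {d : nat} (Omega : set 'rV[R]_d).
Hypothesis bO : bounded_set Omega.

Lemma bounded_closure_enorm : exists2 D : R, 0 < D & forall x, closure Omega x -> enorm x <= D.
Proof.
have [M [_ /(_ (M + 1)) hM]] := bO.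
pose B := d%:R * `|M + 1| + 1; exists (B + 1) => [|x].
  by rewrite /B !ltr_wpDl// addr_ge0// mulr_ge0.
move=> /closure_enormP/(_ 1 ltr01)[y Oy yx].
have yB : enorm y <= B.
  apply: le_trans (enorm_le_normr _) _; rewrite /B.
  apply: (@le_trans _ _ (d%:R * `|M + 1|)); last by rewrite lerDl.
  rewrite ler_wpM2l//; apply: le_trans (ler_norm _).
  by apply: hM => //; rewrite ltrDl.
rewrite -(subrK y x); apply: le_trans (ler_enormD _ _) _.
by rewrite (enorm_distC x); lra.
Qed.

Lemma bounded_lebesgue_fin (A : set 'rV[R]_d) : measurable A -> A `<=` Omega ->
  (rV_lebesgue R d A < +oo)%E.
Proof.
move=> mA AO; have [D D0 OD] := bounded_closure_enorm.
apply: le_lt_trans (rV_lebesgue_diam_le (x0 := 0) (ltW D0) mA _) (ltry _) => x Ax.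
by rewrite subr0; apply: OD; apply: subset_closure; exact: AO.
Qed.

End bounded.

(** * Parametrization of the segments by arc length *)

Section ray_parametrization.
Context {R : realType} {d : nat} (T : 'rV[R]_d -> 'rV[R]_d).

Definition ray_length x : R := enorm (x - T x).
Definition ray_dir x : 'rV[R]_d := (ray_length x)^-1 *: (T x - x).
Definition ray_point (s : R) x : 'rV[R]_d := x + s *: ray_dir x.

Lemma ray_dirE x : 0 < ray_length x -> T x = x + ray_length x *: ray_dir x.
Proof.
move=> x0; rewrite /ray_dir scalerA divff ?gt_eqF// scale1r addrC subrK//.
Qed.

Lemma enorm_ray_dir x : 0 < ray_length x -> enorm (ray_dir x) = 1.
Proof.
move=> x0; rewrite enormZ gtr0_norm ?invr_gt0// enorm_distC -/(ray_length x).
by rewrite mulVf ?gt_eqF.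
Qed.

Lemma measurable_rV_lin2 dsp (X : measurableType dsp) (D : set X) (a : X -> R)
    (u v : X -> 'rV[R]_d) : measurable D ->
  measurable_fun D a -> measurable_fun D u -> measurable_fun D v ->
  measurable_fun D (fun x => u x + a x *: v x).
Proof.
move=> mD ma mu mv; apply: measurable_rV_funP => // i.
apply: (eq_measurable_fun (fun x => u x ord0 i + a x * v x ord0 i)).
  by move=> x _; rewrite !mxE.
apply: measurable_funD; first exact: measurable_rV_coordT.
by apply: measurable_funM => //; exact: measurable_rV_coordT.
Qed.

Context (Omega : set 'rV[R]_d).
Hypotheses (mO : measurable Omega) (mT : measurable_fun Omega T).

Let measurable_gap : measurable_fun Omega (fun x => T x - x).
Proof.
apply: (eq_measurable_fun (fun x => T x + (-1) *: x)).
  by move=> x _; rewrite scaleN1r.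
by apply: measurable_rV_lin2.
Qed.

Lemma measurable_ray_length : measurable_fun Omega ray_length.
Proof.
apply: (eq_measurable_fun (fun x => enorm (T x - x))).
  by move=> x _; rewrite /ray_length enorm_distC.
exact: measurable_enorm.
Qed.

Lemma measurable_ray_dir : measurable_fun Omega ray_dir.
Proof.
apply: (eq_measurable_fun (fun x => 0 + (ray_length x)^-1 *: (T x - x))).
  by move=> x _; rewrite add0r.
apply: (measurable_rV_lin2 (u := cst 0) mO _ (measurable_cst _) measurable_gap).
apply: measurable_funV_gt0 => //; last exact: measurable_ray_length.
by move=> x _; exact: enorm_ge0.
Qed.

Lemma measurable_ray_point (s : R) : measurable_fun Omega (ray_point s).
Proof.
apply: (measurable_rV_lin2 (a := cst s)) => //; exact: measurable_ray_dir.
Qed.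

End ray_parametrization.

(** * Preimages under the flow at a fixed distance [s] *)

Section ray_slice.
Context {R : realType} {d : nat}.
Context (Omega : set 'rV[R]_d) (g : 'rV[R]_d -> R) (la k r : R) (T : 'rV[R]_d -> 'rV[R]_d).
Context (oO : open Omega) (bO : bounded_set Omega) (la0 : 0 <= la) (la1 : la < 1).
Context (lg : elipschitz_on (closure Omega) la g).
Context (dg : forall x, Omega x -> differentiable g x).
Context (k0 : 0 <= k)
  (kg : forall x y, Omega x -> Omega y ->
     enorm (gradient g x - gradient g y) <= k * enorm (x - y)).
Context (r0 : 0 < r) (ball_out : uniform_exterior_ball Omega r).
Context (hT : forall x, Omega x -> boundary_argmin Omega g x (T x)).
Context (mT : measurable_fun Omega T).
Local Notation mu := (rV_lebesgue R d).
Local Notation c := (cone_slope la).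
Local Notation M := (exit_const la r).
Local Notation rho := (ray_length T).

Lemma ray_length_gt0 x : Omega x -> 0 < rho x.
Proof. by move=> Ox; exact: (argmin_enorm_gt0 oO Ox (hT Ox)). Qed.

Lemma ray_argmin x : Omega x -> boundary_argmin Omega g x (x + rho x *: ray_dir T x).
Proof. by move=> Ox; rewrite -ray_dirE ?ray_length_gt0//; exact: hT. Qed.

Lemma ray_point_in x (s : R) : Omega x -> 0 <= s < rho x -> Omega (ray_point T s x).
Proof.
move=> Ox sx; apply: (ray_in oO la0 la1 lg _ sx Ox (ray_argmin Ox)).
by rewrite enorm_ray_dir ?ray_length_gt0.
Qed.

Definition ray_slice (s : R) (A : set 'rV[R]_d) :=
  Omega `&` [set x | s < rho x /\ A (ray_point T s x)].

Let mO : measurable Omega := rV_open_measurable oO.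

Lemma measurable_ray_slice (s : R) A : measurable A -> measurable (ray_slice s A).
Proof.
move=> mA; rewrite (_ : ray_slice s A = (Omega `&` rho @^-1` `]s, +oo[) `&`
    (Omega `&` ray_point T s @^-1` A)).
  apply: measurableI.
    by apply: measurable_ray_length.
  by apply: measurable_ray_point.
apply/seteqP; split=> x /=; rewrite in_itv/= andbT.
  by move=> [Ox [sx Ax]].
by move=> [[Ox sx] [_ Ax]].
Qed.

Definition ray_slice_const (D : R) : R :=
  (8 * inverse_lipschitz_const la k r D * d.+1%:R) ^+ d.

Lemma inverse_lipschitz_const_ge0 (D : R) : 0 <= D -> 0 <= inverse_lipschitz_const la k r D.
Proof.
have := semiconcavity_const_ge0 la0 la1 k0 r0 => K0 D0.
by rewrite /inverse_lipschitz_const addr_ge0// !mulr_ge0.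
Qed.

Lemma ray_slice_const_ge0 (D : R) : 0 <= D -> 0 <= ray_slice_const D.
Proof.
by move=> D0; rewrite exprn_ge0// !mulr_ge0// inverse_lipschitz_const_ge0.
Qed.

(** The points whose segment continues far enough beyond [s] and whose image has room in [U] exhaust
    the slice as [h n] tends to 0, and the covering bound has the same constant for all [n]. *)
Let ray_slice_open (s D : R) U : 0 < s <= D -> open U ->
  (mu (ray_slice s U) <= (ray_slice_const D)%:E * mu U)%E.
Proof.
move=> /andP[s0 sD] oU.
have c0 := cone_slope_gt0 la0 la1; have M1 := exit_const_ge1 la0 la1 r0.
have l1 := la1; have k0' := k0.
(* The two upper bounds on the scale in [good_scale] that do not involve the segment; [k + 1] allows
   [k = 0]. *)
pose hs := Num.min M^-1 ((1 - la) * c / (2 * (k + 1))).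
have hs0 : 0 < hs.
  rewrite lt_min invr_gt0 (lt_le_trans ltr01 M1)/=.
  by apply: divr_gt0; [apply: mulr_gt0 => //|]; lra.
have hs1 : M * hs <= 1.
  rewrite mulrC -ler_pdivlMr ?(lt_le_trans ltr01 M1)// div1r.
  by rewrite /hs ge_min lexx.
have hs2 : k * (2 * hs / c) <= 1 - la.
  have : hs <= (1 - la) * c / (2 * (k + 1)) by rewrite /hs ge_min lexx orbT.
  rewrite ler_pdivlMr; last by lra.
  move=> H; rewrite (_ : _ * (_ / _) = (2 * k * hs) / c); last by field; lra.
  by rewrite ler_pdivrMr//; lra.
pose h n := hs / n.+1%:R.
have h0 n : 0 < h n by rewrite divr_gt0.
have hhs n : h n <= hs by rewrite ler_pdivrMr// ler_peMr ?ler1n// ltW.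
have hle m n : (m <= n)%N -> h n <= h m.
  by move=> mn; rewrite ler_wpM2l ?(ltW hs0)// lef_pV2 ?posrE// ler_nat.
pose F n := Omega `&` [set x | s + 2 * h n / c <= rho x /\
  forall y, enorm (y - ray_point T s x) < h n -> U y].
have mF n : measurable (F n).
  rewrite (_ : F n = (Omega `&` rho @^-1` `[s + 2 * h n / c, +oo[) `&`
    (Omega `&` ray_point T s @^-1` [set z | forall y, enorm (y - z) < h n -> U y])).
    apply: measurableI; first exact: measurable_ray_length.
    apply: measurable_ray_point => //; apply: rV_closed_measurable.
    exact: closed_erosion.
  apply/seteqP; split=> x /=; rewrite in_itv/= andbT.
    by move=> [Ox [sx Ax]].
  by move=> [[Ox sx] [_ Ax]].
have Fle n : (mu (F n) <= (ray_slice_const D)%:E * mu U)%E.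
  apply: (@grid_cover_le _ _ (F n) U (ray_point T s) (h n)) => //.
  - by apply: inverse_lipschitz_const_ge0; lra.
  - apply: measurable_funS (measurable_ray_point mO mT s) => //.
    by move=> x [].
  - exact: rV_open_measurable.
  - move=> x1 x2 [Ox1 [hx1 _]] [Ox2 [hx2 _]] xx.
    have hc : 0 < 2 * h n / c by rewrite divr_gt0// mulr_gt0.
    have gs : good_scale la k r (rho x1 - s) (h n).
      split=> //; [by rewrite lerBrDl| |].
        by apply: le_trans hs1; rewrite ler_wpM2l//; lra.
      apply: le_trans hs2; rewrite ler_wpM2l// ler_wpM2r ?invr_ge0 ?(ltW c0)//.
      by rewrite ler_wpM2l.
    apply: (ray_inverse_lipschitz oO la0 la1 lg dg k0 kg r0 ball_out Ox1 Ox2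
      (enorm_ray_dir (ray_length_gt0 Ox1)) (enorm_ray_dir (ray_length_gt0 Ox2)) _ _ sD
      (ray_argmin Ox1) (ray_argmin Ox2) gs xx); lra.
  - by move=> x w [_ [_]]; exact.
have -> : ray_slice s U = \bigcup_n F n.
  apply/seteqP; split=> [x [Ox [sx Ux]]|x [n _ [Ox [sx Ux]]]]; last first.
    split=> //; split; last by apply: Ux; rewrite subrr enorm0.
    by apply: lt_le_trans sx; rewrite ltrDl divr_gt0// mulr_gt0.
  move/open_enormP : oU => /(_ _ Ux)[e e0 eU].
  pose b := Num.min e ((rho x - s) * c / 2).
  have b0 : 0 < b by rewrite lt_min e0 divr_gt0// mulr_gt0// subr_gt0.
  pose n := Num.truncn (hs / b).
  have hb : h n <= b.
    rewrite /h ler_pdivrMr// mulrC -ler_pdivrMr//.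
    by apply: ltW; exact: truncnS_gt.
  exists n => //; split=> //; split=> [|y yx].
    have : h n <= (rho x - s) * c / 2 by apply: le_trans hb _; rewrite ge_min lexx orbT.
    rewrite ler_pdivlMr// => H; rewrite -lerBrDl ler_pdivrMr//; lra.
  by apply: eU; apply: lt_le_trans yx _; apply: le_trans hb _; rewrite ge_min lexx.
have cF : mu (F n) @[n --> \oo] --> mu (\bigcup_n F n).
  apply: nondecreasing_cvg_mu => //; first exact: bigcup_measurable.
  move=> m n mn; apply/subsetPset => x [Ox [sx Ux]]; split=> //; split.
    apply: le_trans sx; rewrite lerD2l ler_wpM2r ?invr_ge0 ?(ltW c0)//.
    by rewrite ler_wpM2l// hle.
  by move=> y yx; apply: Ux; apply: lt_le_trans yx _; exact: hle.
rewrite -(cvg_lim _ cF)//; apply: lime_le; first by apply/cvg_ex; exists (mu (\bigcup_n F n)).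
by apply: nearW.
Qed.

(** Passage from open to Borel sets. Outer regularity is applied to the measure restricted to
    [Omega], which is finite; this loses nothing because the points [ray_point T s x] with [s] below
    the length stay in [Omega]. *)
Lemma ray_slice_le (s D : R) A : 0 < s <= D -> measurable A ->
  (mu (ray_slice s A) <= (ray_slice_const D)%:E * mu A)%E.
Proof.
move=> sD mA; have D0 : 0 <= D by move/andP: sD => [s0]; lra.
have C0 := ray_slice_const_ge0 D0.
set C := ray_slice_const D in C0 *.
have mAO : measurable (A `&` Omega) by exact: measurableI.
apply: (@le_trans _ _ (C%:E * mu (A `&` Omega))%E); last first.
  by rewrite lee_wpmul2l ?lee_fin// le_measure ?inE.
apply/lee_addgt0Pr => e e0.
have e'0 : 0 < e / (C + 1) by rewrite divr_gt0//; lra.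
have fin : (mrestr mu mO setT < +oo)%E.
  by rewrite /mrestr setTI; exact: (bounded_lebesgue_fin bO).
have [U [oU AU Ue]] := outer_regular (m := mrestr mu mO) fin mAO e'0.
apply: (@le_trans _ _ (mu (ray_slice s (U `&` Omega)))).
  apply: le_measure; rewrite ?inE.
  - exact: measurable_ray_slice.
  - by apply: measurable_ray_slice; apply: rV_open_measurable; exact: openI.
  - move=> x [Ox [sx Ax]]; split=> //; split=> //.
    have Ozx : Omega (ray_point T s x).
      by apply: ray_point_in; rewrite // sx andbT; move/andP: sD => [/ltW].
    by split=> //; apply: AU.
apply: le_trans (ray_slice_open sD (openI oU oO)) _.
rewrite -/C.
have : (mu (U `&` Omega) <= mu (A `&` Omega) + (e / (C + 1))%:E)%E.
  apply: (@le_trans _ _ (mu (A `&` Omega) + mrestr mu mO (U `\` (A `&` Omega)))%E); last first.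
    by rewrite leeD2l// ltW.
  rewrite /mrestr; have mU := rV_open_measurable oU.
  apply: le_trans (measureU2 _ _ _) => //; last first.
    by apply: measurableI => //; exact: measurableD.
  apply: le_measure; rewrite ?inE.
  - exact: measurableI.
  - by apply: measurableU => //; apply: measurableI => //; exact: measurableD.
  - move=> x [Ux Ox]; have [Ax|nA] := pselect ((A `&` Omega) x); first by left.
    by right.
move=> /(@lee_wpmul2l _ C%:E); rewrite lee_fin => /(_ C0) H; apply: le_trans H _.
rewrite ge0_muleDr//; last by rewrite lee_fin ltW.
rewrite leeD2l// -EFinM lee_fin mulrCA ger_pMr// ler_pdivrMr; lra.
Qed.

End ray_slice.

(** * The kernel of segment lengths inside a set, and the bound on its integral *)

Section ray_kernel.
Context {R : realType} {d : nat} (T : 'rV[R]_d -> 'rV[R]_d) (Omega : set 'rV[R]_d).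
Hypotheses (mO : measurable Omega) (mT : measurable_fun Omega T).
Local Notation mu := (rV_lebesgue R d).
Local Notation rho := (ray_length T).
Implicit Types A B : set 'rV[R]_d.

Definition ray_chord x A : set (measurableTypeR R) :=
  [set s | 0 < s < rho x /\ A (ray_point T s x)].

(* The length of the part of the open segment from [x] to [T x] that lies in [A]. *)
Definition ray_kernel x A : \bar R := lebesgue_measure (ray_chord x A).

Definition ray_flow_set A : set ('rV[R]_d * measurableTypeR R) :=
  [set p | Omega p.1 /\ ray_chord p.1 A p.2].

Let measurable_comp_fst (dsp : measure_display) (Y : measurableType dsp) (f : 'rV[R]_d -> Y) :
  measurable_fun Omega f -> measurable_fun (Omega `*` [set: measurableTypeR R]) (f \o fst).
Proof.
move=> mf; apply: (measurable_comp mO _ mf); first by move=> _ [[x s] [Ox _] <-].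
apply: (@measurable_funS _ _ _ _ setT) => //; exact: measurable_fst.
Qed.

Lemma measurable_ray_flow : measurable_fun (Omega `*` [set: measurableTypeR R])
  (fun p => ray_point T p.2 p.1).
Proof.
apply: measurable_rV_lin2; first exact: measurableX.
- apply: (@measurable_funS _ _ _ _ setT) => //; exact: measurable_snd.
- exact: (measurable_comp_fst (f := id)).
- by apply: (measurable_comp_fst (f := ray_dir T)); exact: measurable_ray_dir.
Qed.

Lemma measurable_ray_flow_set A : measurable A -> measurable (ray_flow_set A).
Proof.
move=> mA; pose D := Omega `*` [set: measurableTypeR R].
have mD : measurable D by exact: measurableX.
have m2 : measurable_fun D (fun p => p.2 : R).
  by apply: (@measurable_funS _ _ _ _ setT) => //; exact: measurable_snd.
have mrho : measurable_fun D (fun p => rho p.1 - p.2).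
  apply: measurable_funB => //; apply: (measurable_comp_fst (f := rho)).
  exact: measurable_ray_length.
have mpt := measurable_ray_flow.
rewrite (_ : ray_flow_set A = (D `&` (fun p => p.2) @^-1` `]0, +oo[) `&`
    ((D `&` (fun p => rho p.1 - p.2) @^-1` `]0, +oo[) `&`
     (D `&` (fun p => ray_point T p.2 p.1) @^-1` A))).
  apply: measurableI; first by apply: m2.
  by apply: measurableI; [apply: mrho|apply: mpt].
apply/seteqP; split=> -[x s] /=; rewrite !in_itv/= !andbT subr_gt0.
  by move=> [Ox [/andP[s0 sx] Ax]].
by move=> [[[Ox _] s0] [[_ sx] [_ Ax]]]; do 2 split=> //; rewrite s0.
Qed.

Lemma xsection_ray_flow_set A x : Omega x -> xsection (ray_flow_set A) x = ray_chord x A.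
Proof.
move=> Ox; apply/seteqP; split=> s; rewrite /xsection /= inE.
  by move=> [].
by move=> h; split.
Qed.

Lemma measurable_ray_chord A x : Omega x -> measurable A -> measurable (ray_chord x A).
Proof.
move=> Ox mA; rewrite -xsection_ray_flow_set//.
by apply: measurable_xsection; exact: measurable_ray_flow_set.
Qed.

Lemma measurable_ray_kernel A : measurable A -> measurable_fun Omega (ray_kernel ^~ A).
Proof.
move=> mA; apply: (eq_measurable_fun (lebesgue_measure \o xsection (ray_flow_set A))).
  by move=> x; rewrite inE => Ox /=; rewrite xsection_ray_flow_set.
apply: (@measurable_funS _ _ _ _ setT) => //.
by apply: measurable_fun_xsection; exact: measurable_ray_flow_set.
Qed.

Lemma ray_kernel_ge0 x A : (0 <= ray_kernel x A)%E.
Proof. exact: measure_ge0. Qed.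

Lemma ray_kernel_set0 x : ray_kernel x set0 = 0%E.
Proof.
rewrite /ray_kernel (_ : ray_chord x set0 = set0) ?measure0//.
by rewrite -subset0 => s [].
Qed.

Lemma ray_kernel_bigcup x (F : (set 'rV[R]_d)^nat) : Omega x ->
  (forall n, measurable (F n)) -> trivIset setT F ->
  ray_kernel x (\bigcup_n F n) = (\sum_(0 <= n <oo) ray_kernel x (F n))%E.
Proof.
move=> Ox mF tF; rewrite /ray_kernel.
rewrite (_ : ray_chord x _ = \bigcup_n ray_chord x (F n)); last first.
  apply/seteqP; split=> [s [sx [n _ Fn]]|s [n _ [sx Fn]]]; first by exists n.
  by split=> //; exists n.
rewrite measure_bigcup.
- by apply: eq_eseriesl => n; rewrite in_setT.
- by move=> n _; exact: measurable_ray_chord.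
apply/trivIsetP => i j _ _ ij; rewrite -subset0 => s [[_ Fi] [_ Fj]].
by move/trivIsetP : tF => /(_ i j I I ij); rewrite -subset0 => /(_ _ (conj Fi Fj)).
Qed.

Lemma ray_kernel_le_length x A : Omega x -> measurable A ->
  (ray_kernel x A <= (rho x)%:E)%E.
Proof.
move=> Ox mA; have rx : 0 <= rho x := enorm_ge0 _.
apply: (@le_trans _ _ (lebesgue_measure (`[0, rho x]%classic : set (measurableTypeR R)))).
  apply: le_measure; rewrite ?inE//; first exact: measurable_ray_chord.
  by move=> s [/andP[s0 s1] _]; rewrite /= in_itv/= !ltW.
rewrite lebesgue_measure_itv/= lte_fin; case: ifP => // _.
by rewrite sube0.
Qed.

(** Tonelli: the sections at fixed [s] are the slices, and they are empty unless [0 < s <= D],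
    whence the factor [D]. *)
Lemma integral_ray_kernel_le (C D : R) A :
  0 <= C -> 0 <= D -> (forall x, Omega x -> rho x <= D) ->
  (forall s, 0 < s <= D -> (mu (ray_slice Omega T s A) <= C%:E * mu A)%E) ->
  measurable A ->
  (\int[mu]_(x in Omega) ray_kernel x A <= (C * D)%:E * mu A)%E.
Proof.
move=> C0 D0 rD sC mA; have mW := measurable_ray_flow_set mA.
have -> : (\int[mu]_(x in Omega) ray_kernel x A)%E =
    (\int[mu]_x lebesgue_measure (xsection (ray_flow_set A) x))%E.
  rewrite integral_mkcond; apply: eq_integral => x _; rewrite /patch.
  case: ifPn => [|]; first by rewrite inE => Ox; rewrite xsection_ray_flow_set.
  move=> /negP nOx; rewrite (_ : xsection _ _ = set0) ?measure0//.
  by rewrite -subset0 => s; rewrite /xsection /= inE => -[Ox _]; apply: nOx; rewrite inE.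
have := indic_fubini_tonelli mu (@lebesgue_measure R) mW.
rewrite indic_fubini_tonelli_FE// indic_fubini_tonelli_GE//= => ->.
apply: (@le_trans _ _ (\int[@lebesgue_measure R]_(s in `[0%R, D]) (cst (C%:E * mu A)%E s))%E).
  rewrite [leRHS]integral_mkcond; apply: ge0_le_integral => //.
  - by apply: measurable_fun_ysection.
  - have mI : measurable (`[0, D]%classic : set (measurableTypeR R)) by exact: measurable_itv.
    by apply: (proj1 (@measurable_restrictT _ _ _ _ _ _ mI) _); exact: measurable_cst.
  move=> s _; rewrite /patch; case: ifPn => [|/negP].
    rewrite inE /= in_itv/= => /andP[s0 sD].
    have [{}s0|s0'] := ltP 0 s; last first.
      rewrite (_ : ysection _ _ = set0) ?measure0 ?mule_ge0//.
      rewrite -subset0 => x; rewrite /ysection /= inE => -[_ [/andP[s1 _] _]].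
      by move: s1; rewrite /= ltNge s0'.
    rewrite (_ : ysection _ _ = ray_slice Omega T s A); first by apply: sC; rewrite s0.
    apply/seteqP; split=> x; rewrite /ysection /= inE /=.
      by move=> [Ox [/andP[_ sx] Ax]].
    by move=> [Ox [sx Ax]]; do 2 split=> //; rewrite s0.
  move=> ns; rewrite (_ : ysection _ _ = set0) ?measure0//.
  rewrite -subset0 => x; rewrite /ysection /= inE => -[Ox [/andP[/= s0 sx] _]].
  by apply: ns; rewrite inE /= in_itv/= (ltW s0) (le_trans (ltW sx)) ?rD.
rewrite integral_cst//= lebesgue_measure_itv/= lte_fin.
case: ifPn => [_|]; first by rewrite sube0 (mulrC C) EFinM muleC muleA.
by rewrite mule0 => _; rewrite mule_ge0// lee_fin mulr_ge0.
Qed.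

(** It serves twice: with a representative of [f], for comparison with [sigma], and with its power
    [q], for the measure that controls the level sets of the density. *)
Lemma ray_measure_exists (w : 'rV[R]_d -> R) :
  measurable_fun Omega w -> (forall x, Omega x -> 0 <= w x) ->
  exists tau : {measure set 'rV[R]_d -> \bar R},
    forall A, tau A = (\int[mu]_(x in Omega) ((w x)%:E * ray_kernel x A))%E.
Proof.
move=> mw w0.
pose f A := (\int[mu]_(x in Omega) ((w x)%:E * ray_kernel x A))%E.
have f0 : f set0 = 0%E.
  by rewrite /f integral0_eq// => x _; rewrite ray_kernel_set0 mule0.
have fge A : (0 <= f A)%E.
  by apply: integral_ge0 => x Ox; rewrite mule_ge0 ?lee_fin ?w0.
have fsig : semi_sigma_additive f.
  move=> F mF tF mbF.
  have -> : f (\bigcup_n F n) = (\sum_(0 <= n <oo) f (F n))%E.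
    rewrite /f -integral_nneseries//.
    - apply: eq_integral => x; rewrite inE => Ox.
      by rewrite ray_kernel_bigcup// nneseriesZl.
    - move=> n; apply: emeasurable_funM; first exact/measurable_EFinP.
      exact: measurable_ray_kernel.
    - by move=> n x Ox; rewrite mule_ge0 ?lee_fin ?w0.
  by apply: is_cvg_ereal_nneg_natsum_cond => n _ _; exact: fge.
pose tau : {measure set 'rV[R]_d -> \bar R} :=
  HB.pack f (isMeasure.Build _ _ _ f f0 fge fsig).
by exists tau.
Qed.

End ray_kernel.

(** * Continuous approximation of indicators of open sets *)

Section real_valued.
Context {R : realType} {d : nat}.
Implicit Types (U : set 'rV[R]_d) (f : 'rV[R]_d -> R).

Lemma rV_continuous_measurable_real f : continuous f -> measurable_fun setT f.
Proof.
move=> /continuousP cf; apply: (measurability _ (RGenOpens.measurableE R)).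
move=> _ [_ [a [b ->] <-]]; rewrite setTI; apply: rV_open_measurable.
by apply: cf; exact: interval_open.
Qed.


Lemma elipschitz_continuous f (k : R) : 0 <= k ->
  (forall x y, `|f x - f y| <= k * enorm (x - y)) -> continuous f.
Proof.
move=> k0 fk x A /nbhs_ballP[e /= e0 eA].
pose c := k * d%:R + 1; have c0 : 0 < c by rewrite ltr_wpDl// mulr_ge0.
apply/nbhs_ballP; exists (e / c); first by rewrite /= divr_gt0.
move=> y; rewrite -ball_normE /ball_ /= => xy; apply: eA.
rewrite -ball_normE /ball_ /=; apply: le_lt_trans (fk x y) _.
move: xy; rewrite ltr_pdivlMr//; apply: le_lt_trans.
apply: (@le_trans _ _ (k * (d%:R * `|x - y|))).
  by rewrite ler_wpM2l// enorm_le_normr.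
by rewrite mulrA mulrC ler_wpM2l// /c lerDl.
Qed.

(* For an open set other than the whole space, [n] times the distance to the complement, capped
   at [1], increases to the indicator. *)
Lemma open_indic_approx U : open U -> exists phi : nat -> 'rV[R]_d -> R,
  [/\ forall n, continuous (phi n), forall n x, 0 <= phi n x <= 1,
      forall x m n, (m <= n)%N -> phi m x <= phi n x
    & forall x, phi n x @[n --> \oo] --> (\1_U x : R)].
Proof.
move=> oU; have [->|UT] := eqVneq U setT.
  exists (fun _ _ => 1); split=> //.
  - by move=> n; exact: cst_continuous.
  - by move=> n x; rewrite ler01 lexx.
  - by move=> x; rewrite indicE in_setT; exact: cvg_cst.
have [w0 nU0] : exists w, ~ U w.
  by apply/existsNP => UA; move/eqP: UT; apply; apply/seteqP; split.
pose S x : set R := [set enorm (x - w) | w in ~` U].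
pose dU x := inf (S x).
have S0 x : S x !=set0 by exists (enorm (x - w0)), w0.
have lbS x : has_lbound (S x) by exists 0 => _ [w _ <-]; exact: enorm_ge0.
have dU0 x : 0 <= dU x by apply: lb_le_inf => // _ [w _ <-]; exact: enorm_ge0.
have dUle x y : dU x - dU y <= enorm (x - y).
  rewrite lerBlDr -lerBlDl; apply: lb_le_inf => // _ [w nUw <-].
  rewrite lerBlDl; apply: (@le_trans _ _ (enorm (x - w))); last exact: ler_enorm_dist.
  by apply: ge_inf => //; exists w.
have dUl x y : `|dU x - dU y| <= enorm (x - y).
  by rewrite ler_norml dUle andbT lerNl opprB enorm_distC dUle.
pose phi n x := Num.min 1 (n%:R * dU x) : R.
exists phi; split.
- move=> n; apply: (@elipschitz_continuous _ n%:R) => // x y.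
  have H a b : `|Num.min 1 a - Num.min 1 b| <= `|a - b| :> R.
    have [] := leP 1 a; have [] := leP 1 b; rewrite ?subrr ?normr0//.
    - by move=> b1 a1; rewrite !ger0_norm; lra.
    - by move=> b1 a1; rewrite !ler0_norm; lra.
  apply: le_trans (H _ _) _; rewrite -mulrBr normrM ger0_norm//.
  by rewrite ler_wpM2l.
- by move=> n x; rewrite /phi le_min ler01 mulr_ge0//= ge_min lexx.
- move=> x m n mn; rewrite /phi le_min ge_min lexx/= ge_min ler_wpM2r ?orbT//.
  by rewrite ler_nat.
- move=> x; rewrite indicE; have [Ux|nUx] := pselect (U x).
    rewrite mem_set//=.
    have [e e0 eU] : exists2 e : R, 0 < e & e <= dU x.
      move/open_enormP : oU => /(_ _ Ux)[e e0 eU]; exists e => //.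
      apply: lb_le_inf => // _ [w nUw <-]; rewrite leNgt; apply/negP => we.
      by apply: nUw; apply: eU; rewrite enorm_distC.
    apply: cvg_near_cst; near=> n.
    apply/min_idPl; apply: (@le_trans _ _ (n%:R * e)); last by rewrite ler_wpM2l.
    rewrite -ler_pdivrMr// div1r; near: n; exact: nbhs_infty_ger.
  rewrite memNset//=.
  have -> : phi ^~ x = cst 0; last exact: cvg_cst.
  apply/funext => n; rewrite /phi /= (_ : dU x = 0) ?mulr0.
    by apply/min_idPr.
  apply/eqP; rewrite eq_le dU0 andbT; apply: ge_inf => //.
  by exists x => //; rewrite subrr enorm0.
Unshelve. all: by end_near. Qed.

End real_valued.

(** * Integrals along segments in arc length *)

Section segment_integral.
Context {R : realType} {d : nat} (T : 'rV[R]_d -> 'rV[R]_d).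
Local Notation rho := (ray_length T).
Implicit Types (phi : 'rV[R]_d -> R).

Definition ray_integral phi x : \bar R :=
  (\int[@lebesgue_measure R]_(s in `]0%R, rho x[) (phi (ray_point T s x))%:E)%E.

Lemma ray_point_continuous phi x : continuous phi ->
  continuous (fun s : R => phi (ray_point T s x)).
Proof.
move=> cphi s; apply: (@continuous_comp _ _ _ (fun s : R => ray_point T s x) phi); last exact: cphi.
move=> A /nbhs_ballP[e /= e0 eA].
apply/nbhs_ballP; exists (e / (enorm (ray_dir T x) + 1)).
  by rewrite /= divr_gt0// ltr_wpDl// enorm_ge0.
move=> t; rewrite /ball /= ltr_pdivlMr ?ltr_wpDl ?enorm_ge0// => st; apply: eA.
rewrite -ball_normE /ball_ /=; apply: le_lt_trans (normr_le_enorm _) _.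
rewrite /ray_point opprD addrACA subrr add0r -scalerBl enormZ.
by apply: le_lt_trans st; rewrite ler_wpM2l// lerDl.
Qed.

(** The substitution [s = rho x * t] absorbs the weight [enorm (x - T x)]. *)
Lemma segment_integralE phi x (a : R) : continuous phi -> 0 < rho x ->
  (\int[lebesgue_measure]_(t in `[0%R, 1%R])
     (enorm (x - T x) * phi ((1 - t) *: x + t *: T x) * a)%:E =
   a%:E * ray_integral phi x)%E.
Proof.
move=> cphi rx.
pose G (s : R) : R := phi (ray_point T s x); pose F (t : R) : R := rho x * t.
have cG : continuous G := ray_point_continuous (x := x) cphi.
have dF (t : R) : derive1 F t = rho x.
  by rewrite /F derive1Ml// derive1_id mulr1.
have cF : continuous F by move=> t; apply: mulrl_continuous.
have FT (t : R) : ray_point T (F t) x = (1 - t) *: x + t *: T x.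
  by rewrite [in RHS](ray_dirE rx) /ray_point /F; apply/rowP => i; rewrite !mxE; ring.
have -> : (\int[lebesgue_measure]_(t in `[0%R, 1%R])
     (enorm (x - T x) * phi ((1 - t) *: x + t *: T x) * a)%:E =
   \int[lebesgue_measure]_(t in `[0%R, 1%R]) (a%:E * (((G \o F) * (derive1 F)) t)%:E))%E.
  apply: eq_integral => t _; rewrite -EFinM; congr EFin.
  by rewrite !fctE /= dF /G FT /ray_length; ring.
rewrite integralZl//; last first.
  apply: (@continuous_compact_integrable R); first exact: segment_compact.
  apply: continuous_subspaceT => t.
  have -> : (G \o F) * (derive1 F) = (fun t => G (F t) * rho x) by apply/funext => u; rewrite !fctE /= dF.
  by apply: cvgMr_tmp; apply: (@continuous_comp _ _ _ F G); [exact: cF|exact: cG].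
rewrite -integration_by_substitution_increasing//.
- rewrite /F mulr0 mulr1 integral_itv_bndoo//.
  apply/measurable_EFinP; apply: (@measurable_funS _ _ _ _ setT) => //.
  exact: continuous_measurable_fun.
- by move=> u v _ _ uv; rewrite /F ltr_pM2l.
- move=> t _; rewrite (_ : derive1 F = cst (rho x)); first exact: cst_continuous.
  by apply/funext.
- rewrite (_ : derive1 F = cst (rho x)); first exact: is_cvg_cst.
  by apply/funext.
- rewrite (_ : derive1 F = cst (rho x)); first exact: is_cvg_cst.
  by apply/funext.
- split.
  + by move=> t _; apply: derivableM.
  + by apply: cvg_at_right_filter; exact: cF.
  + by apply: cvg_at_left_filter; exact: cF.
- exact: continuous_subspaceT.
Qed.

Context (Omega : set 'rV[R]_d).
Hypotheses (mO : measurable Omega) (mT : measurable_fun Omega T).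

Lemma measurable_ray_integral phi : continuous phi -> (forall x, 0 <= phi x) ->
  measurable_fun Omega (ray_integral phi).
Proof.
move=> cphi phi0; have mW := measurable_ray_flow_set mO mT measurableT.
pose h : 'rV[R]_d * measurableTypeR R -> \bar R :=
  (fun p => (phi (ray_point T p.2 p.1))%:E) \_ (ray_flow_set T Omega setT).
have mh : measurable_fun setT h.
  apply: (proj1 (@measurable_restrictT _ _ _ _ _ _ mW) _).
  apply/measurable_EFinP; apply: (measurable_comp measurableT) => //.
    exact: rV_continuous_measurable_real.
  apply: measurable_funS (measurable_ray_flow mO mT); first exact: measurableX.
  by move=> [x s] [].
apply: (eq_measurable_fun (fubini_F (@lebesgue_measure R) h)); last first.
  apply: (@measurable_funS _ _ _ _ setT) => //.
  apply: measurable_fun_fubini_tonelli_F => // p.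
  by apply: erestrict_ge0 => q _; rewrite lee_fin.
move=> x; rewrite inE => Ox; rewrite /fubini_F /ray_integral [RHS]integral_mkcond.
apply: eq_integral => s _; rewrite /h /patch; congr (if _ then _ else _).
apply/idP/idP; rewrite !inE /= in_itv/=.
  by move=> [_ []].
by move=> sx; split.
Qed.

End segment_integral.

(** * Identification of [sigma] with a superposition of the kernel *)

Section density.
Context {R : realType} {d : nat} (T : 'rV[R]_d -> 'rV[R]_d) (Omega : set 'rV[R]_d).
Hypotheses (mO : measurable Omega) (mT : measurable_fun Omega T).
Local Notation mu := (rV_lebesgue R d).
Local Notation rho := (ray_length T).
Hypothesis rho0 : forall x, Omega x -> 0 < rho x.
Context (f w : 'rV[R]_d -> R).
Hypotheses (mf : measurable_fun Omega f) (mw : measurable_fun Omega w)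
  (w0 : forall x, Omega x -> 0 <= w x)
  (fw : {ae mu, forall x, Omega x -> f x = w x}).
Context (sigma : {measure set 'rV[R]_d -> \bar R}).
Hypothesis hsigma : is_transport_density Omega f T sigma.

(** Replaces [f] by a representative that is nonnegative at every point of [Omega], as the monotone
    convergence below requires. *)
Lemma transport_density_integral (phi : 'rV[R]_d -> R) : continuous phi -> (forall x, 0 <= phi x) ->
  (\int[sigma]_(x in closure Omega) (phi x)%:E =
   \int[mu]_(x in Omega) ((w x)%:E * ray_integral T phi x))%E.
Proof.
move=> cphi phi0; rewrite (hsigma.2 phi); last exact: continuous_subspaceT.
transitivity (\int[mu]_(x in Omega) ((f x)%:E * ray_integral T phi x))%E.
  by apply: eq_integral => x; rewrite inE => Ox; rewrite segment_integralE// rho0.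
have mR := measurable_ray_integral mO mT cphi phi0.
apply: ae_eq_integral => //.
- by apply: emeasurable_funM => //; exact/measurable_EFinP.
- by apply: emeasurable_funM => //; exact/measurable_EFinP.
- by apply: filterS fw => x fwx Ox; rewrite fwx.
Qed.

(** Monotone convergence along [open_indic_approx], three times: under [sigma], along each segment,
    and under [mu]. *)
Lemma transport_density_open (U : set 'rV[R]_d) : open U ->
  sigma U = (\int[mu]_(x in Omega) ((w x)%:E * ray_kernel T x U))%E.
Proof.
move=> oU; have [phi [cphi phi01 phi_le phi_cvg]] := open_indic_approx oU.
have mU := rV_open_measurable oU.
have mC : measurable (closure Omega).
  by apply: rV_closed_measurable; exact: closed_closure.
have phi0 n x : 0 <= phi n x by case/andP: (phi01 n x).
have L1 : (\int[sigma]_(x in closure Omega) (phi n x)%:E)%E @[n --> \oo] --> sigma U.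
  have -> : sigma U = (\int[sigma]_(x in closure Omega) limn (fun n => (phi n x)%:E))%E.
    transitivity (sigma (U `&` closure Omega)).
      apply/eqP; rewrite eq_le; apply/andP; split; last first.
        by apply: le_measure; rewrite ?inE//; exact: measurableI.
      apply: (@le_trans _ _ (sigma (U `&` closure Omega) + sigma (~` closure Omega))%E).
        apply: le_trans (measureU2 _ _ _); last 2 first.
          exact: measurableI.
          exact: measurableC.
        apply: le_measure; rewrite ?inE//.
          by apply: measurableU; [exact: measurableI|exact: measurableC].
        by move=> x Ux; have [Cx|nCx] := pselect (closure Omega x); [left|right].
      by rewrite hsigma.1 adde0.
    rewrite -integral_indic//; apply: eq_integral => x _.
    apply/esym/cvg_lim => //; apply: cvg_EFin; first by apply: nearW.
    exact: phi_cvg.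
  apply: cvg_monotone_convergence => //.
  - move=> n; apply/measurable_EFinP; apply: (@measurable_funS _ _ _ _ setT) => //.
    exact: rV_continuous_measurable_real.
  - by move=> n x _; rewrite lee_fin.
  - by move=> x _ m n mn; rewrite lee_fin phi_le.
have K_le x m n : (m <= n)%N -> (ray_integral T (phi m) x <= ray_integral T (phi n) x)%E.
  move=> mn; apply: ge0_le_integral => //.
  - by move=> s _; rewrite lee_fin.
  - apply/measurable_EFinP; apply: (@measurable_funS _ _ _ _ setT) => //.
    by apply: continuous_measurable_fun; exact: ray_point_continuous.
  - apply/measurable_EFinP; apply: (@measurable_funS _ _ _ _ setT) => //.
    by apply: continuous_measurable_fun; exact: ray_point_continuous.
  - by move=> s _; rewrite lee_fin phi_le.
have K0 n x : (0 <= ray_integral T (phi n) x)%E.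
  by apply: integral_ge0 => s _; rewrite lee_fin.
have K_cvg x : Omega x ->
    ray_integral T (phi n) x @[n --> \oo] --> ray_kernel T x U.
  move=> Ox; rewrite /ray_integral.
  have -> : ray_kernel T x U = (\int[@lebesgue_measure R]_(s in `]0%R, rho x[)
      limn (fun n => (phi n (ray_point T s x))%:E))%E.
    transitivity (\int[@lebesgue_measure R]_(s in `]0%R, rho x[)
        (\1_(ray_chord T x U) s)%:E)%E.
      rewrite integral_indic//; last exact: (measurable_ray_chord mO mT).
      congr lebesgue_measure; apply/seteqP; split=> s.
        by move=> [sx Us]; split; [split|rewrite /= in_itv].
      by move=> [].
    apply: eq_integral => s; rewrite inE /= in_itv/= => sx.
    apply/esym/cvg_lim => //; apply: cvg_EFin; first by apply: nearW.
    have := phi_cvg (ray_point T s x); rewrite !indicE.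
    rewrite (_ : (s \in ray_chord T x U) = (ray_point T s x \in U))//.
    by apply/idP/idP; rewrite !inE; [case|].
  apply: cvg_monotone_convergence => //.
  - move=> n; apply/measurable_EFinP; apply: (@measurable_funS _ _ _ _ setT) => //.
    by apply: continuous_measurable_fun; exact: ray_point_continuous.
  - by move=> n s _; rewrite lee_fin.
  - by move=> s _ m n mn; rewrite lee_fin phi_le.
have L2 : (\int[mu]_(x in Omega) ((w x)%:E * ray_integral T (phi n) x))%E @[n --> \oo] -->
    (\int[mu]_(x in Omega) ((w x)%:E * ray_kernel T x U))%E.
  have -> : (\int[mu]_(x in Omega) ((w x)%:E * ray_kernel T x U) =
      \int[mu]_(x in Omega) limn (fun n => (w x)%:E * ray_integral T (phi n) x))%E.
    apply: eq_integral => x; rewrite inE => Ox; apply/esym/cvg_lim => //.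
    by apply: cvgeZl => //; exact: K_cvg.
  apply: cvg_monotone_convergence => //.
  - move=> n; apply: emeasurable_funM; first exact/measurable_EFinP.
    exact: measurable_ray_integral.
  - by move=> n x Ox; rewrite mule_ge0 ?lee_fin ?w0.
  - by move=> x Ox m n mn; rewrite lee_wpmul2l ?lee_fin ?w0// K_le.
have E : (fun n => \int[sigma]_(x in closure Omega) (phi n x)%:E)%E =
    (fun n => \int[mu]_(x in Omega) ((w x)%:E * ray_integral T (phi n) x))%E.
  by apply/funext => n; rewrite transport_density_integral.
rewrite E in L1; exact: (cvg_unique _ L1 L2).
Qed.

(** The open sets are stable under intersection and generate the Borel sets, so agreement on them
    extends once the total mass is finite. *)
Lemma transport_densityE A :
  (\int[mu]_(x in Omega) ((w x)%:E * ray_kernel T x setT) < +oo)%E -> measurable A ->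
  sigma A = (\int[mu]_(x in Omega) ((w x)%:E * ray_kernel T x A))%E.
Proof.
move=> fin mA; have [tau tauE] := ray_measure_exists mO mT mw w0.
rewrite -tauE; apply: (@measure_unique _ _ _ (@open 'rV[R]_d) (fun=> setT)) => //.
- exact: openI.
- by move=> _; exact: openT.
- by apply/seteqP; split=> // x _; exists 0%N.
- by move=> U oU; rewrite tauE transport_density_open.
- by move=> _; rewrite transport_density_open//; exact: openT.
Qed.

End density.

(** * Densities of measures given by a kernel with both marginals bounded *)

Lemma finite_density (dsp : measure_display) (X : measurableType dsp) (R : realType)
    (mu : {sigma_finite_measure set X -> \bar R}) (sigma : {measure set X -> \bar R}) :
  (sigma setT < +oo)%E -> sigma `<< mu ->
  exists h : X -> R, [/\ measurable_fun setT h, forall x, 0 <= h x &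
    forall A, measurable A -> sigma A = (\int[mu]_(x in A) (h x)%:E)%E].
Proof.
move=> sfin smu.
pose nu : {finite_measure set X -> \bar R} := mfrestr measurableT sfin.
have nuE A : nu A = sigma A by rewrite /nu /= /mfrestr /mrestr setIT.
have nmu : nu `<< mu by move=> A /smu A0 E mE EA; rewrite nuE; exact: A0.
have [f [f0 ffin fint fE]] := radon_nikodym_sigma_finite nmu.
have fK x : (fine (f x))%:E = f x by rewrite fineK.
exists (fine \o f); split.
- apply/measurable_EFinP; apply: (eq_measurable_fun f); first by move=> x _ /=; rewrite fK.
  by case/integrableP: fint.
- by move=> x; rewrite fine_ge0.
- by move=> A mA; rewrite -nuE fE//; apply: eq_integral => x _; rewrite /= fK.
Qed.

Section kernel_density.
Context (dsp : measure_display) (X : measurableType dsp) (R : realType).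
Context (mu : {sigma_finite_measure set X -> \bar R}) (Omega : set X).
Context (kappa : X -> set X -> \bar R) (B D : R).
Hypotheses (mO : measurable Omega) (muO : (mu Omega < +oo)%E).
Hypotheses (B0 : 0 <= B) (D0 : 0 <= D).
Hypothesis kappa0 : forall x A, (0 <= kappa x A)%E.
Hypothesis mkappa : forall A, measurable A -> measurable_fun Omega (kappa ^~ A).
Hypothesis kappaD : forall x A, Omega x -> measurable A -> (kappa x A <= D%:E)%E.
Hypothesis kappaB : forall A, measurable A ->
  (\int[mu]_(x in Omega) kappa x A <= B%:E * mu A)%E.
Context (sigma : {measure set X -> \bar R}) (w : X -> R).
Hypotheses (mw : measurable_fun Omega w) (w0 : forall x, Omega x -> 0 <= w x).
Hypothesis sigmaE : forall A, measurable A ->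
  sigma A = (\int[mu]_(x in Omega) ((w x)%:E * kappa x A))%E.

(** On a null set [A], [kappaB] makes [kappa ^~ A] vanish almost everywhere, whatever the weight. *)
Lemma kernel_dominates : sigma `<< mu.
Proof.
apply/null_content_dominatesP => A mA muA0; rewrite sigmaE//.
have k0 : (\int[mu]_(x in Omega) `|kappa x A|)%E = 0%E.
  apply/eqP; rewrite eq_le integral_ge0// andbT.
  rewrite (eq_integral (kappa ^~ A)); last by move=> x _; rewrite gee0_abs.
  by apply: le_trans (kappaB mA) _; rewrite muA0 mule0.
have ae0 := (ae_eq_integral_abs mu mO (mkappa mA)).1 k0.
transitivity (\int[mu]_(x in Omega) cst 0%E x)%E; last by rewrite integral0.
apply: ae_eq_integral => //.
- by apply: emeasurable_funM; [exact/measurable_EFinP|exact: mkappa].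
- by apply: filterS ae0 => x kx Ox; rewrite kx// mule0.
Qed.

Context (h : X -> R).
Hypotheses (mh : measurable_fun setT h) (h0 : forall x, 0 <= h x).
Hypothesis sigmah : forall A, measurable A -> sigma A = (\int[mu]_(x in A) (h x)%:E)%E.

Lemma density_ge_le (a : R) A : 0 <= a -> measurable A -> (forall x, A x -> a <= h x) ->
  (a%:E * mu A <= sigma A)%E.
Proof.
move=> a0 mA ah; rewrite sigmah// -integral_cst//; apply: ge0_le_integral => //.
by apply/measurable_EFinP; apply: (@measurable_funS _ _ _ _ setT).
Qed.

(** Where [h] exceeds [M * B + 1], the density bounds [sigma] from below and the kernel from above
    by incompatible multiples of [mu], unless the set is null. The margin 1 spares a limit. *)
Lemma kernel_density_bounded (M : R) : 0 <= M -> (forall x, Omega x -> w x <= M) ->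
  {ae mu, forall x, Omega x -> h x <= M * B + 1}.
Proof.
move=> M0 wM; pose A := Omega `&` h @^-1` `]M * B + 1, +oo[.
have mA : measurable A.
  by apply: measurableI => //; rewrite -[X in measurable X]setTI; apply: mh.
exists A; split => //; last first.
  move=> x /= /not_implyP[Ox hx]; split=> //=.
  by rewrite in_itv/= andbT ltNge; apply/negP.
have MB0 : 0 <= M * B by rewrite mulr_ge0.
have muA : (mu A < +oo)%E.
  by apply: le_lt_trans muO; rewrite le_measure ?inE//; exact: subIsetl.
have lo : ((M * B + 1)%:E * mu A <= sigma A)%E.
  apply: density_ge_le => //; first by lra.
  by move=> x [_]; rewrite /= in_itv/= andbT => /ltW.
have hi : (sigma A <= (M * B)%:E * mu A)%E.
  rewrite sigmaE//; apply: (@le_trans _ _ (\int[mu]_(x in Omega) (M%:E * kappa x A))%E).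
    apply: ge0_le_integral => //.
    - by move=> x Ox; rewrite mule_ge0 ?lee_fin ?w0.
    - by apply: emeasurable_funM; [exact/measurable_EFinP|exact: mkappa].
    - by apply: emeasurable_funM => //; exact: mkappa.
    - by move=> x Ox; rewrite lee_wpmul2r ?lee_fin ?wM.
  rewrite ge0_integralZl//; last exact: mkappa.
  by rewrite EFinM -muleA lee_wpmul2l ?kappaB.
move: (le_trans lo hi).
have -> : mu A = (fine (mu A))%:E by rewrite fineK// ge0_fin_numE.
have := fine_ge0 (measure_ge0 mu A); move: (fine (mu A)) => m m0.
by rewrite -!EFinM lee_fin => H; congr EFin; lra.
Qed.

Context (q : R) (q1 : 1 <= q) (nu : {measure set X -> \bar R}).
Hypothesis wq : (\int[mu]_(x in Omega) (w x `^ q)%:E < +oo)%E.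
Hypothesis nuE : forall A, nu A = (\int[mu]_(x in Omega) ((w x `^ q)%:E * kappa x A))%E.

Let q0 : q != 0. Proof. by rewrite gt_eqF// (lt_le_trans ltr01). Qed.

Let nu_fin : (nu setT < +oo)%E.
Proof.
have mwq : measurable_fun Omega (fun x => (w x `^ q)%:E).
  by apply/measurable_EFinP; apply: (measurableT_comp (measurable_powR _)).
rewrite nuE; apply: (@le_lt_trans _ _ (\int[mu]_(x in Omega) (D%:E * (w x `^ q)%:E))%E).
  apply: ge0_le_integral => //.
  - by move=> x Ox; rewrite mule_ge0 ?lee_fin ?powR_ge0.
  - by apply: emeasurable_funM => //; exact: mkappa.
  - exact: emeasurable_funM.
  - by move=> x Ox; rewrite muleC lee_wpmul2r ?lee_fin ?powR_ge0// kappaD.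
rewrite ge0_integralZl//; last by move=> x _; rewrite lee_fin powR_ge0.
by rewrite lte_mul_pinfty.
Qed.

Let eps : R := (2 * B + 1)^-1.

Let eps0 : 0 < eps. Proof. by rewrite invr_gt0; have := B0; lra. Qed.

(* Above the threshold [eps * a] the weight [w] is at most [(eps * a) `^ (1 - q) * w `^ q], and
   [eps * B <= 1 / 2] lets the remaining part be absorbed. *)
Let density_level (a : R) A : 0 < a -> measurable A -> A `<=` Omega ->
  (forall x, A x -> a <= h x) ->
  ((a `^ q)%:E * mu A <= (2 * eps `^ (1 - q))%:E * nu A)%E.
Proof.
move=> a0 mA AO ah; have ea0 : 0 < eps * a by rewrite mulr_gt0.
have wle x : Omega x -> w x <= eps * a + (eps * a) `^ (1 - q) * w x `^ q.
  move=> Ox; have [wx|wx] := leP (w x) (eps * a).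
    by apply: le_trans wx _; rewrite lerDl mulr_ge0 ?powR_ge0.
  have wx0 : 0 < w x by exact: lt_trans wx.
  apply: (@le_trans _ _ ((eps * a) `^ (1 - q) * w x `^ q)); last by rewrite lerDr ltW.
  rewrite -[leLHS](powRr1 (ltW wx0)) -(subrK q 1) powRD; last first.
    by rewrite subrK oner_eq0.
  rewrite subrK ler_wpM2r ?powR_ge0// -opprB !powRN lef_pV2 ?posrE ?powR_gt0//.
  by rewrite ge0_ler_powR ?nnegrE ?subr_ge0// ltW.
have muA : (mu A < +oo)%E by apply: le_lt_trans muO; rewrite le_measure ?inE.
have mka := mkappa mA.
have mwq : measurable_fun Omega (fun x => (w x `^ q)%:E).
  by apply/measurable_EFinP; apply: (measurableT_comp (measurable_powR _)).
have hi : (sigma A <= (eps * a * B)%:E * mu A + ((eps * a) `^ (1 - q))%:E * nu A)%E.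
  rewrite sigmaE//; apply: (@le_trans _ _ (\int[mu]_(x in Omega)
    ((eps * a)%:E * kappa x A + ((eps * a) `^ (1 - q))%:E * ((w x `^ q)%:E * kappa x A)))%E).
    apply: ge0_le_integral => //.
    - by move=> x Ox; rewrite mule_ge0 ?lee_fin ?w0.
    - by apply: emeasurable_funM => //; exact/measurable_EFinP.
    - by apply: emeasurable_funD; [exact: emeasurable_funM|apply: emeasurable_funM => //; exact: emeasurable_funM].
    - move=> x Ox; rewrite muleA -ge0_muleDl; last 2 first.
      + by rewrite lee_fin ltW.
      + by rewrite mule_ge0 ?lee_fin ?powR_ge0.
      by rewrite lee_wpmul2r// -EFinM -EFinD lee_fin wle.
  rewrite ge0_integralD//; last 4 first.
  - by move=> x Ox; rewrite mule_ge0 ?lee_fin ?(ltW ea0).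
  - exact: emeasurable_funM.
  - by move=> x Ox; rewrite !mule_ge0 ?lee_fin ?powR_ge0.
  - by apply: emeasurable_funM => //; exact: emeasurable_funM.
  rewrite ge0_integralZl// ?lee_fin ?(ltW ea0)//.
  rewrite ge0_integralZl//; last 3 first.
  - exact: emeasurable_funM.
  - by move=> x Ox; rewrite mule_ge0 ?lee_fin ?powR_ge0.
  - by rewrite lee_fin powR_ge0.
  rewrite -nuE leeD2r// (EFinM (eps * a) B) -muleA lee_wpmul2l ?lee_fin ?(ltW ea0)//.
  exact: kappaB.
have lo := density_ge_le (ltW a0) mA ah.
move: (le_trans lo hi).
have nuA : (nu A < +oo)%E by apply: le_lt_trans nu_fin; rewrite le_measure ?inE.
have -> : mu A = (fine (mu A))%:E by rewrite fineK// ge0_fin_numE.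
have -> : nu A = (fine (nu A))%:E by rewrite fineK// ge0_fin_numE.
have := fine_ge0 (measure_ge0 mu A); have := fine_ge0 (measure_ge0 nu A).
move: (fine (mu A)) (fine (nu A)) => m n n0 m0.
rewrite -!EFinM -EFinD !lee_fin => H.
have epsB : eps * B <= 1 / 2.
  by rewrite /eps mulrC ler_pdivrMr; have := B0; lra.
have H1 : a * m <= 2 * ((eps * a) `^ (1 - q) * n).
  have : eps * B * (a * m) <= 1 / 2 * (a * m) by rewrite ler_wpM2r// mulr_ge0// ltW.
  lra.
(* Multiplying by the power [q - 1] of [a] cancels the powers of [a] on the right. *)
have H2 : a `^ (q - 1) * (a * m) <= a `^ (q - 1) * (2 * ((eps * a) `^ (1 - q) * n)).
  by rewrite ler_wpM2l ?powR_ge0.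
have aq : a `^ q = a `^ (q - 1) * a.
  rewrite -{3}(powRr1 (ltW a0)) -powRD ?subrK//.
  by rewrite (negbTE q0).
have a1 : a `^ (q - 1) * a `^ (1 - q) = 1.
  rewrite -powRD; last by apply/implyP => _; rewrite gt_eqF.
  by rewrite addrA subrK subrr powRr0.
rewrite (powRM _ (ltW eps0) (ltW a0)) in H2.
rewrite aq -mulrA; apply: le_trans H2 _.
rewrite [leLHS](_ : _ = 2 * eps `^ (1 - q) * n * (a `^ (q - 1) * a `^ (1 - q))); last by ring.
by rewrite a1 mulr1.
Qed.

(** [density_level] is summed over dyadic levels of [h]: the level sets are disjoint, so the
    right-hand sides add up to at most a multiple of the finite mass of [nu]. *)
Lemma kernel_density_Lp : (\int[mu]_(x in Omega) (h x `^ q)%:E < +oo)%E.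
Proof.
have q0' : 0 < q by exact: lt_le_trans ltr01 q1.
(* Level 0 is [[0, 1[], where finiteness of [mu Omega] suffices; level [n.+1] runs from [2 ^+ n] to
   [2 ^+ n.+1]. *)
pose c (n : nat) : R := if n is m.+1 then 2 ^+ m else 0.
pose A n := Omega `&` h @^-1` `[c n, c n.+1[.
have mA n : measurable (A n).
  by apply: measurableI => //; rewrite -[X in measurable X]setTI; apply: mh.
have cS n : c n <= c n.+1.
  by case: n => [|n] /=; [rewrite expr0|rewrite exprS ler_peMl// ?exprn_ge0// ler1n].
have cle m n : (m <= n)%N -> c m <= c n.
  by move=> mn; apply: (@homo_leq _ c (fun x y => x <= y)) mn => // x y z; exact: le_trans.
have tA : trivIset setT A.
  apply/trivIsetP => i j _ _; rewrite neq_ltn => ij; rewrite -subset0 => x.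
  rewrite /A /= !in_itv/= => -[[_ /andP[i1 i2]] [_ /andP[j1 j2]]].
  move: ij => /orP[/cle|/cle]; rewrite leNgt => /negP; apply.
    exact: le_lt_trans j1 i2.
  exact: le_lt_trans i1 j2.
have bA : Omega = \bigcup_n A n.
  apply/seteqP; split=> [x Ox|x [n _ []]//].
  have ex : exists n, h x < c n.+1.
    exists (Num.truncn (h x)).+1; apply: lt_trans (truncnS_gt _) _ => /=.
    by rewrite -natrX ltr_nat ltn_expl.
  have [n hn nmin] := ex_minnP ex; exists n => //; split=> //=.
  rewrite in_itv/= hn andbT; case: n hn nmin => [_ _|n _ nmin]; first exact: h0.
  by rewrite leNgt; apply/negP => /nmin; rewrite ltnn.
have mhq E : measurable E -> measurable_fun E (fun x => (h x `^ q)%:E).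
  move=> mE; apply/measurable_EFinP; apply: (measurableT_comp (measurable_powR _)).
  exact: (@measurable_funS _ _ _ _ setT).
pose C := 2 `^ q * (2 * eps `^ (1 - q)).
have C0 : 0 <= C by rewrite !mulr_ge0 ?powR_ge0.
have An n : (\int[mu]_(x in A n) (h x `^ q)%:E <= C%:E * nu (A n) + mu (A n))%E.
  apply: (@le_trans _ _ ((c n.+1 `^ q)%:E * mu (A n))%E).
    rewrite -integral_cst//; apply: ge0_le_integral => //.
    - by move=> x _; rewrite lee_fin powR_ge0.
    - exact: mhq.
    - move=> x [_]; rewrite /= in_itv/= => /andP[_ hc]; rewrite lee_fin.
      have c0 := ltW (le_lt_trans (h0 x) hc).
      by apply: ge0_ler_powR; rewrite ?nnegrE ?(ltW q0') ?(ltW hc) ?h0 ?c0.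
  case: n => [|n] /=.
    by rewrite expr0 powR1 mul1e leeDr// mule_ge0.
  rewrite exprS powRM ?exprn_ge0//; apply: (@le_trans _ _ (C%:E * nu (A n.+1))%E).
    rewrite /C !EFinM -!muleA lee_wpmul2l ?lee_fin ?powR_ge0// muleA -EFinM.
    apply: density_level => //; first by move=> x [].
    by move=> x [_]; rewrite /= in_itv/= => /andP[].
  by rewrite leeDl.
rewrite bA ge0_integral_bigcup//; last 2 first.
- by apply: mhq; exact: bigcup_measurable.
- by move=> x _; rewrite lee_fin powR_ge0.
apply: (@le_lt_trans _ _ (\sum_(0 <= n <oo) (C%:E * nu (A n) + mu (A n)))%E).
  apply: lee_nneseries => [n _ _|n _]; last exact: An.
  by apply: integral_ge0 => x _; rewrite lee_fin powR_ge0.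
have sum (m : {measure set X -> \bar R}) : (\sum_(0 <= n <oo) m (A n))%E = m Omega.
  rewrite bA measure_bigcup//.
  by apply: eq_eseriesl => n; rewrite in_setT.
rewrite nneseriesD//; last by move=> n _ _; rewrite mule_ge0.
rewrite nneseriesZl// !sum lte_add_pinfty// lte_mul_pinfty//.
by apply: le_lt_trans nu_fin; rewrite le_measure ?inE.
Qed.

End kernel_density.

(** * Finiteness of Lebesgue norms on the domain *)

Section Lnorm_restrict.
Context {R : realType} {d : nat} (Omega : set 'rV[R]_d).
Local Notation mu := (rV_lebesgue R d).
Implicit Types f : 'rV[R]_d -> R.

Lemma Lnorm_restrict_fin f (q : R) : 1 <= q ->
  (Lnorm mu q%:E (fun x => (f x * \1_Omega x)%:E) < +oo)%E <->
  (\int[mu]_(x in Omega) (`|f x| `^ q)%:E < +oo)%E.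
Proof.
move=> q1; have q0 : q != 0 by rewrite gt_eqF// (lt_le_trans ltr01).
rewrite unlock; have -> : (\int[mu]_x `|(f x * \1_Omega x)%:E| `^ q =
    \int[mu]_(x in Omega) (`|f x| `^ q)%:E)%E.
  rewrite [RHS]integral_mkcond; apply: eq_integral => x _.
  rewrite /patch indicE; case: ifP => _ /=; first by rewrite mulr1.
  by rewrite mulr0 normr0 powR0.
split; last exact: poweR_lty.
by apply: lty_poweRy; rewrite invr_neq0.
Qed.

Lemma Linfty_restrict_bounded f :
  (Lnorm mu +oo (fun x => (f x * \1_Omega x)%:E) < +oo)%E ->
  exists2 M : R, 0 <= M & {ae mu, forall x, Omega x -> f x <= M}.
Proof.
rewrite unlock; case: ifPn => [_|].
  set F := abse \o _; move=> hs; exists (Num.max 0 (fine (ess_sup mu F))).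
    by rewrite le_max lexx.
  apply: filterS (ess_sup_ge mu F) => x Fx Ox.
  have {Fx} : ((`|f x|)%:E <= ess_sup mu F)%E.
    by apply: le_trans Fx; rewrite /F /= indicE mem_set// mulr1.
  move: hs; case: (ess_sup mu F) => [s| |]// _; rewrite lee_fin => fs.
  by rewrite le_max (le_trans (ler_norm _) fs) orbT.
(* The norm is 0 by convention when the whole space is null; then every property holds almost
   everywhere. *)
rewrite -leNgt => mu0 _; exists 0 => //.
exists setT; split=> //; apply/eqP; rewrite eq_le mu0; exact: measure_ge0.
Qed.

Lemma bounded_Linfty_restrict f (M : R) : 0 <= M -> (forall x, 0 <= f x) ->
  {ae mu, forall x, Omega x -> f x <= M} ->
  (Lnorm mu +oo (fun x => (f x * \1_Omega x)%:E) < +oo)%E.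
Proof.
move=> M0 f0 fM; rewrite unlock; case: ifP => _; last exact: ltry.
apply: (@le_lt_trans _ _ M%:E); last exact: ltry.
apply/ess_supP; apply: filterS fM => x fx /=; rewrite lee_fin indicE.
have [Ox|nOx] := boolP (x \in Omega); last by rewrite mulr0 normr0.
by rewrite mulr1 ger0_norm// fx//; rewrite inE in Ox.
Qed.

End Lnorm_restrict.

(** * Assembly: constants, representatives of [f], and the two ranges of [p] *)

Unset Implicit Arguments.

Theorem proposition3p9 (R : realType) (d : nat) (Omega : set 'rV[R]_d) (r : R)
    (g : 'rV[R]_d -> R) (lambda : R) (p : \bar R) (f : 'rV[R]_d -> R)
    (T : 'rV[R]_d -> 'rV[R]_d) (sigma : {measure set 'rV[R]_d -> \bar R}) :
  bounded_domain Omega ->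
  0 < r -> uniform_exterior_ball Omega r ->
  C11_closure Omega g ->
  elipschitz_on (closure Omega) lambda g -> lambda < 1 ->
  (1 <= p)%E ->
  {ae rV_lebesgue R d, forall x, Omega x -> 0 <= f x} -> memLp Omega p f ->
  borel_selector Omega g T ->
  is_transport_density Omega f T sigma ->
  measure_in_Lp Omega p sigma.
Proof.
move=> [_ oO _ bO] r0 ball_out [_ dg [k0 kg0]] lg0 lambda1 p1 f0 [mf fp] [mT0 hT0] hsigma.
have mO : measurable Omega := rV_open_measurable oO.
have mC : measurable (closure Omega).
  by apply: rV_closed_measurable; exact: closed_closure.
have OC : Omega `<=` closure Omega by exact: subset_closure.
(* The given constants may be negative in degenerate cases. *)
pose la := Num.max 0 lambda; pose k := Num.max 0 k0.
have la0 : 0 <= la by rewrite le_max lexx.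
have la1 : la < 1 by rewrite gt_max ltr01.
have lg : elipschitz_on (closure Omega) la g.
  move=> x y Cx Cy; apply: le_trans (lg0 _ _ Cx Cy) _.
  by rewrite ler_wpM2r ?enorm_ge0// le_max lexx orbT.
have kk0 : 0 <= k by rewrite le_max lexx.
have kg x y : Omega x -> Omega y -> enorm (gradient g x - gradient g y) <= k * enorm (x - y).
  move=> Ox Oy; apply: le_trans (kg0 _ _ Ox Oy) _.
  by rewrite ler_wpM2r ?enorm_ge0// le_max lexx orbT.
have hT x : Omega x -> boundary_argmin Omega g x (T x) by move=> /OC; exact: hT0.
have mT : measurable_fun Omega T by exact: measurable_funS mT0.
have [E E0 CE] := bounded_closure_enorm bO.
pose D := E + E; have D0 : 0 <= D by rewrite addr_ge0// ltW.
have rhoD x : Omega x -> ray_length T x <= D.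
  move=> Ox; apply: le_trans (ler_enormD _ _) _; rewrite enormN.
  by rewrite lerD// CE//; [exact: OC|have [[]] := hT x Ox].
have rho0 x : Omega x -> 0 < ray_length T x by exact: (ray_length_gt0 oO hT).
pose C := ray_slice_const la k r D (d := d).
have C0 : 0 <= C by exact: ray_slice_const_ge0.
pose kappa := ray_kernel T; pose B := C * D.
have B0 : 0 <= B by rewrite mulr_ge0.
have muO : (rV_lebesgue R d Omega < +oo)%E by exact: (bounded_lebesgue_fin bO).
have mkappa A : measurable A -> measurable_fun Omega (kappa ^~ A).
  by exact: measurable_ray_kernel.
have kappa0 x A : (0 <= kappa x A)%E by exact: ray_kernel_ge0.
have kappaD x A : Omega x -> measurable A -> (kappa x A <= D%:E)%E.
  move=> Ox mA; apply: le_trans (ray_kernel_le_length mO mT Ox mA) _.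
  by rewrite lee_fin rhoD.
have kappaB A : measurable A ->
    (\int[rV_lebesgue R d]_(x in Omega) kappa x A <= B%:E * rV_lebesgue R d A)%E.
  move=> mA; apply: (integral_ray_kernel_le mO mT C0 D0 rhoD _ mA) => s sD.
  exact: (ray_slice_le oO bO la0 la1 lg dg kk0 kg r0 ball_out hT mT sD mA).
(* The representative is left free because the two ranges of [p] use different ones: the positive
   part of [f], and its truncation at an essential bound. *)
have sigma_w (w : 'rV[R]_d -> R) : measurable_fun Omega w ->
    (forall x, Omega x -> 0 <= w x) ->
    {ae rV_lebesgue R d, forall x, Omega x -> f x = w x} ->
    (\int[rV_lebesgue R d]_(x in Omega) (w x)%:E < +oo)%E ->
    [/\ forall A, measurable A ->
      sigma A = (\int[rV_lebesgue R d]_(x in Omega) ((w x)%:E * kappa x A))%E,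
    sigma `<< rV_lebesgue R d &
    exists h : 'rV[R]_d -> R, [/\ measurable_fun setT h, forall x, 0 <= h x,
      forall A, measurable A -> sigma A = (\int[rV_lebesgue R d]_(x in A) (h x)%:E)%E &
      forall A, measurable A ->
        sigma A = (\int[rV_lebesgue R d]_(x in A `&` Omega) (h x)%:E)%E]].
  move=> mw w0 fw wfin.
  have mwE : measurable_fun Omega (fun x => (w x)%:E) by exact/measurable_EFinP.
  have kfin : (\int[rV_lebesgue R d]_(x in Omega) ((w x)%:E * kappa x setT) < +oo)%E.
    apply: (@le_lt_trans _ _ (\int[rV_lebesgue R d]_(x in Omega) (D%:E * (w x)%:E))%E).
      apply: ge0_le_integral => //.
      - by move=> x Ox; rewrite mule_ge0 ?lee_fin ?w0.
      - by apply: emeasurable_funM => //; exact: mkappa.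
      - exact: emeasurable_funM.
      - by move=> x Ox; rewrite muleC lee_wpmul2r ?lee_fin ?w0// kappaD.
    by rewrite ge0_integralZl// lte_mul_pinfty.
  have sE A : measurable A ->
      sigma A = (\int[rV_lebesgue R d]_(x in Omega) ((w x)%:E * kappa x A))%E.
    exact: (transport_densityE mO mT rho0 mf mw w0 fw hsigma).
  have smu := kernel_dominates mO kappa0 mkappa kappaB mw sE.
  split=> //; have [|h [mh h0 hE]] := finite_density _ smu.
    by rewrite sE.
  exists h; split=> // A mA; have mAO : measurable (A `&` Omega) by exact: measurableI.
  (* [sigma] does not charge the boundary: the open segments lie in [Omega], so the kernel takes the
     same value on [A] and on its trace in [Omega]. *)
  rewrite -hE// !sE//; apply: eq_integral => x; rewrite inE => Ox; congr (_ * _)%E.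
  congr lebesgue_measure; apply/seteqP; split=> s [sx Ax]; split=> //; last by case: Ax.
  split=> //; apply: (ray_point_in oO la0 la1 lg hT Ox).
  by case/andP: sx => s0 ->; rewrite ltW.
have mf0 : measurable_fun Omega (fun x => Num.max 0 (f x)).
  by apply: measurable_maxr.
have mhO (h : 'rV[R]_d -> R) : measurable_fun setT h -> measurable_fun Omega h.
  by apply: measurable_funS.
case: p p1 fp => [q|_|//].
- rewrite lee_fin => q1 /(Lnorm_restrict_fin _ _ q1) fq.
  pose w x := Num.max 0 (f x) : R.
  have w0 x : 0 <= w x by rewrite le_max lexx.
  have fw : {ae rV_lebesgue R d, forall x, Omega x -> f x = w x}.
    by apply: filterS f0 => x fx Ox; rewrite /w max_r// fx.
  have q0 : 0 <= q by apply: le_trans q1.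
  have mwq : measurable_fun Omega (fun x => w x `^ q).
    exact: (measurableT_comp (measurable_powR _)).
  have wq : (\int[rV_lebesgue R d]_(x in Omega) (w x `^ q)%:E < +oo)%E.
    apply: le_lt_trans fq; apply: ge0_le_integral => //.
    - by move=> x _; rewrite lee_fin powR_ge0.
    - exact/measurable_EFinP.
    - apply/measurable_EFinP; apply: (measurableT_comp (measurable_powR _)).
      exact: measurableT_comp.
    - move=> x _; rewrite lee_fin; apply: ge0_ler_powR; rewrite ?nnegrE//.
      by rewrite /w ge_max normr_ge0 ler_norm.
  have wfin : (\int[rV_lebesgue R d]_(x in Omega) (w x)%:E < +oo)%E.
    apply: (@le_lt_trans _ _ (\int[rV_lebesgue R d]_(x in Omega) (cst 1 x + (w x `^ q)%:E))%E).
      apply: ge0_le_integral => //.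
      - by move=> x _; rewrite lee_fin.
      - exact/measurable_EFinP.
      - by apply: emeasurable_funD => //; exact/measurable_EFinP.
      - move=> x _; rewrite -EFinD lee_fin; have [w1|w1] := leP (w x) 1.
          by apply: le_trans w1 _; rewrite lerDl powR_ge0.
        rewrite -[leLHS](powRr1 (w0 x)); apply: le_trans (ler_powR (ltW w1) q1) _.
        by rewrite lerDr.
    rewrite ge0_integralD//; last 2 first.
    - by move=> x _; rewrite lee_fin powR_ge0.
    - exact/measurable_EFinP.
    by rewrite integral_cst// mul1e lte_add_pinfty.
  have [sE smu [h [mh h0 hE hEO]]] := sigma_w w mf0 (fun x _ => w0 x) fw wfin.
  have [nu nuE] := ray_measure_exists mO mT mwq (fun x _ => powR_ge0 (w x) q).
  split=> //; exists h; split=> //; split; first exact: mhO.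
  apply/(Lnorm_restrict_fin _ _ q1).
  rewrite (eq_integral (fun x => (h x `^ q)%:E)); last first.
    by move=> x _; rewrite ger0_norm.
  exact: (kernel_density_Lp mO muO B0 D0 kappa0 mkappa kappaD kappaB mf0 (fun x _ => w0 x)
    sE mh h0 hE q1 wq nuE).
- move=> /Linfty_restrict_bounded[M M0 fM].
  pose w x := Num.min (Num.max 0 (f x)) M : R.
  have w0 x : 0 <= w x by rewrite le_min M0 le_max lexx.
  have wM x : w x <= M by rewrite ge_min lexx orbT.
  have mw : measurable_fun Omega w by apply: measurable_minr.
  have fw : {ae rV_lebesgue R d, forall x, Omega x -> f x = w x}.
    apply: filterS2 f0 fM => x fx fMx Ox; rewrite /w max_r ?fx// min_l// fMx//.
  have wfin : (\int[rV_lebesgue R d]_(x in Omega) (w x)%:E < +oo)%E.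
    apply: (@le_lt_trans _ _ (\int[rV_lebesgue R d]_(x in Omega) (cst M%:E x))%E).
      apply: ge0_le_integral => //.
      - by move=> x _; rewrite lee_fin.
      - exact/measurable_EFinP.
      - by move=> x _; rewrite lee_fin.
    by rewrite integral_cst// lte_mul_pinfty.
  have [sE smu [h [mh h0 hE hEO]]] := sigma_w w mw (fun x _ => w0 x) fw wfin.
  split=> //; exists h; split=> //; split; first exact: mhO.
  apply: (@bounded_Linfty_restrict _ _ _ _ (M * B + 1)) => //.
    by rewrite addr_ge0// mulr_ge0.
  exact: (kernel_density_bounded mO muO B0 kappa0 mkappa kappaB mw (fun x _ => w0 x) sE mh hE
    M0 (fun x _ => wM x)).
Qed.
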